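(* Let $u,\widetilde u:\Omega\to\mathbb R$ have weak gradients in $L^2(\Omega,\mu;\mathbb R^d)$, with $\mathbf C_u=\mathbb E_\mu[\nabla u\,\nabla u^\top]$ and $\widetilde{\mathbf C}=\mathbb E_\mu[\nabla\widetilde u\,\nabla\widetilde u^\top]$. Let $\nu_1\ge\dots\ge\nu_d\ge0$ be the eigenvalues of $\mathbf C_u$ and assume that for some $1\le r_{\rm AS}<d$ the eigengap $\Delta:=\nu_{r_{\rm AS}}-\nu_{r_{\rm AS}+1}$ is positive. Let $\widehat{\mathbf C}$ be the empirical covariance of $\nabla\widetilde u$ described in the context, and suppose $$\|\widehat{\mathbf C}-\widetilde{\mathbf C}\|_{\rm op}+\|\widetilde{\mathbf C}-\mathbf C_u\|_{\rm op}\le\Delta/2.$$ Let $W,\widehat W_{r_{\rm AS}}\in\mathbb R^{d\times r_{\rm AS}}$ have orthonormal columns spanning the leading $r_{\rm AS}$-dimensional eigenspaces of $\mathbf C_u$ and $\widehat{\mathbf C}$, respectively. Then $$\|\sin\Theta(\widehat W_{r_{\rm AS}},W)\|_{\rm op}\le\frac2\Delta\Bigl[\|\widehat{\mathbf C}-\widetilde{\mathbf C}\|_{\rm op}+\bigl(\|\nabla u\|_{L^2_\mu}+\|\nabla\widetilde u\|_{L^2_\mu}\bigr)\|\nabla(u-\widetilde u)\|_{L^2_\mu}\Bigr].$$ If moreover $\|\nabla\widetilde u(x)\|_2\le G_\nabla$ almost surely and $N_{\rm AS}\gtrsim\log(d/\eta)$ for some $\eta\in(0,1)$, then with probability at least $1-\eta$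 the first term satisfies $\|\widehat{\mathbf C}-\widetilde{\mathbf C}\|_{\rm op}=O\bigl(G_\nabla^2\sqrt{\log(d/\eta)/N_{\rm AS}}\bigr)$.
   Context: $\Omega\subset\mathbb R^d$ is a product domain with product probability reference measure $\mu$ (on $(0,1)^d$, Lebesgue measure); $\|\nabla v\|_{L^2_\mu}=(\int_\Omega\|\nabla v\|_2^2\,d\mu)^{1/2}$. In the application $u$ is a PDE solution and $\widetilde u$ a fitted (possibly random) predictor. The empirical covariance is $\widehat{\mathbf C}=\frac1{N_{\rm AS}}\sum_{n=1}^{N_{\rm AS}}\nabla\widetilde u(x_n)\nabla\widetilde u(x_n)^\top$, where, conditionally on $\widetilde u$, the points $x_1,\dots,x_{N_{\rm AS}}$ are drawn independently from $\mu$ (independent of the samples used to construct $\widetilde u$). $\Theta(\cdot,\cdot)$ denotes the principal angles between column spaces and $\|\cdot\|_{\rm op}$ the operator norm. Implicit constants in $\gtrsim$ and $O(\cdot)$ are universal. *)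

(* Defs.v *)
From HB Require Import structures.
From mathcomp Require Import all_boot all_order all_algebra.
From mathcomp Require Import all_classical all_reals all_analysis.
From mathcomp Require Import measurable_realfun.

Set Implicit Arguments.
Unset Strict Implicit.
Unset Printing Implicit Defensive.

Import Order.TTheory GRing.Theory Num.Theory.
Import numFieldNormedType.Exports.

Local Open Scope classical_set_scope.
Local Open Scope ring_scope.

Definition measure_cV_display : measure_display. Proof. exact. Qed.

(* R^n (column vectors) carries the product sigma-algebra, generated by the
   coordinates; it is the Borel one, see [measurable_open_cV]. *)
Section measurable_cV.
Context {R : realType} {n : nat}.

Let coords : 'I_n -> 'cV[R]_n -> measurableTypeR R := fun i x => x i ord0.

Let cV_set0 : g_sigma_preimage coords set0.
Proof. exact: sigma_algebra0. Qed.

Let cV_setC A : g_sigma_preimage coords A -> g_sigma_preimage coords (~` A).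
Proof. exact: sigma_algebraC. Qed.

Let cV_bigcup (F : (set 'cV[R]_n)^nat) :
  (forall i, g_sigma_preimage coords (F i)) ->
  g_sigma_preimage coords (\bigcup_i F i).
Proof. exact: sigma_algebra_bigcup. Qed.

HB.instance Definition _ := @isMeasurable.Build measure_cV_display
  'cV[R]_n (g_sigma_preimage coords) cV_set0 cV_setC cV_bigcup.

Lemma measurable_coord (i : 'I_n) :
  measurable_fun [set: 'cV[R]_n] (fun x => x i ord0 : measurableTypeR R).
Proof.
move=> _ Y mY; rewrite setTI; apply: sub_sigma_algebra => /=.
rewrite -bigcup_seq/=; exists i => /=; first by rewrite mem_index_enum.
by exists Y => //; rewrite setTI.
Qed.

Lemma measurable_fun_cV d (T : measurableType d) (D : set T)
    (f : T -> 'cV[R]_n) :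
  (forall i, measurable_fun D (fun t => f t i ord0 : measurableTypeR R)) ->
  measurable_fun D f.
Proof.
move=> mf mD B mB.
have : g_sigma_preimage coords `<=` [set A | measurable (D `&` f @^-1` A)].
  apply: smallest_sub.
    split => /=.
    - by rewrite preimage_set0 setI0.
    - move=> A mA; rewrite setTD preimage_setC -setDE.
      rewrite -[X in measurable X]set0U -(setDv D) -setDIr.
      exact: measurableD.
    - move=> F mF; rewrite preimage_bigcup setI_bigcupr.
      exact: bigcup_measurable.
  rewrite -bigcup_seq => A [i _ [C mC <-]] /=.
  by rewrite setTI; exact: mf.
exact.
Qed.

Lemma measurable_box (A : 'I_n -> set (measurableTypeR R)) :
  (forall i, measurable (A i)) ->
  measurable [set x : 'cV[R]_n | forall i, A i (x i ord0)].
Proof.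
move=> mA; have -> : [set x : 'cV[R]_n | forall i, A i (x i ord0)] =
    \bigcap_(i in [set: 'I_n]) ((fun x : 'cV[R]_n => x i ord0) @^-1` A i).
  by apply/seteqP; split => x /= xA i; [move=> _; exact: xA|exact: xA].
apply: fin_bigcap_measurable => // i _; rewrite -[X in measurable X]setTI.
exact: (measurable_coord i).
Qed.

Lemma open_cV_box (U : set 'cV[R]_n) (x : 'cV[R]_n) : open U -> U x ->
  exists2 e : R, 0 < e &
    forall y : 'cV[R]_n, (forall i, `|x i ord0 - y i ord0| < e) -> U y.
Proof.
move=> oU Ux; have /nbhs_ballP[e /= e0 eU] : nbhs x U by exact: open_nbhs_nbhs.
by exists e => // y xy; apply: eU; split => // i j; rewrite (ord1 j); exact: xy.
Qed.

Lemma measurable_open_cV (U : set 'cV[R]_n) : open U -> measurable U.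
Proof.
move=> oU.
pose box (q : {ffun 'I_n -> rat * rat}) :=
  \bigcap_(i in [set: 'I_n])
    [set x : 'cV[R]_n | `](ratr (q i).1), (ratr (q i).2)[%classic (x i ord0)].
pose Q := [set q | box q `<=` U].
have -> : U = \bigcup_(q in Q) box q.
  apply/seteqP; split => [x Ux|x [q Qq]]; last exact: Qq.
  have [e e0 eU] := open_cV_box oU Ux.
  have qP i : exists q : rat * rat, x i ord0 - e < ratr q.1 < x i ord0 /\
      x i ord0 < ratr q.2 < x i ord0 + e.
    have [|a] := @rat_in_itvoo R (x i ord0 - e) (x i ord0).
      by rewrite ltrBlDr ltrDl.
    rewrite in_itv/= => aP.
    have [|b] := @rat_in_itvoo R (x i ord0) (x i ord0 + e).
      by rewrite ltrDl.
    by rewrite in_itv/= => bP; exists (a, b).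
  pose q := [ffun i => sval (cid (qP i))].
  have qE i := svalP (cid (qP i)).
  exists q => [y yq|i _ /=].
    apply: eU => i; have := yq i I; rewrite /= in_itv/= ffunE.
    have [/andP[x1 x2] /andP[x3 x4]] := qE i.
    move=> /andP[y1 y2]; rewrite ltr_norml; apply/andP; split.
      by rewrite ltrBrDr addrC -ltrBrDr opprK (lt_trans y2).
    by rewrite ltrBlDr addrC -ltrBlDr (lt_trans _ y1).
  rewrite in_itv/= ffunE; have [/andP[x1 x2] /andP[x3 x4]] := qE i.
  by rewrite x2 x3.
rewrite bigcup_mkcond; apply: countable_bigcupT_measurable => [|q].
  exact: countableP.
case: ifP => // _; apply: fin_bigcap_measurable => // i _.
rewrite -[X in measurable X]setTI.
apply: (measurable_coord i) => //; exact: measurable_itv.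
Qed.

Lemma continuous_measurable_cV (f : 'cV[R]_n -> R) :
  continuous f -> measurable_fun [set: 'cV[R]_n] f.
Proof.
move=> /continuousP cf; apply: (measurability _ (RGenOpens.measurableE R)).
move=> _ [_ [a [b ->] <-]]; rewrite setTI; apply: measurable_open_cV.
by apply: cf; exact: interval_open.
Qed.
End measurable_cV.

Section product_measure_cV.
Context {R : realType}.
Local Open Scope ereal_scope.

Definition cons_cV n (p : measurableTypeR R * 'cV[R]_n) : 'cV[R]_n.+1 :=
  \col_i oapp (fun j => p.2 j ord0) p.1 (unlift ord0 i).

Lemma measurable_cons_cV n : measurable_fun [set: _] (@cons_cV n).
Proof.
apply: measurable_fun_cV => i.
have [j ->|->] := unliftP ord0 i.
- rewrite (_ : (fun _ => _) = (fun x : 'cV[R]_n => x j ord0) \o snd); last first.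
    by apply/funext => p /=; rewrite mxE liftK.
  by apply: measurableT_comp => //; exact: measurable_coord.
- rewrite (_ : (fun _ => _) = fst) //.
  by apply/funext => p /=; rewrite mxE unlift_none.
Qed.

HB.instance Definition _ n := isMeasurableFun.Build _ _ _ _ (@cons_cV n)
  (@measurable_cons_cV n).

Section cons_measure.
Variables (n : nat) (m1 : {sigma_finite_measure set (measurableTypeR R) -> \bar R}).
Variable m2 : {sigma_finite_measure set 'cV[R]_n -> \bar R}.

Definition cons_measure : set 'cV[R]_n.+1 -> \bar R :=
  pushforward (m1 \x m2) (@cons_cV n).

Let cm0 : cons_measure set0 = 0.
Proof. exact: measure0. Qed.

Let cm_ge0 A : 0 <= cons_measure A.
Proof. exact: measure_ge0. Qed.

Let cm_sigma_additive : semi_sigma_additive cons_measure.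
Proof.
exact: measure_semi_sigma_additive.
Qed.

HB.instance Definition _ := isMeasure.Build _ _ _ cons_measure
  cm0 cm_ge0 cm_sigma_additive.

Let cm_sigma_finite : sigma_finite [set: _] cons_measure.
Proof.
have [F FT mF] := sigma_finiteT m1; have [G GT mG] := sigma_finiteT m2.
pose tail (x : 'cV[R]_n.+1) : 'cV[R]_n := \col_j x (lift ord0 j) ord0.
have mtail : measurable_fun [set: _] tail.
  apply: measurable_fun_cV => j; rewrite (_ : (fun _ => _) =
    (fun x : 'cV[R]_n.+1 => x (lift ord0 j) ord0)); first exact: measurable_coord.
  by apply/funext => x; rewrite mxE.
pose A (i j : nat) := [set x : 'cV[R]_n.+1 | F i (x ord0 ord0)] `&` (tail @^-1` G j).
have mA i j : measurable (A i j).
  apply: measurableI.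
    rewrite -[X in measurable X]setTI; apply: (measurable_coord ord0) => //.
    by have [] := mF i.
  by rewrite -[X in measurable X]setTI; apply: mtail => //; have [] := mG j.
exists (fun k => if unpickle k is Some (i, j) then A i j else set0).
  rewrite eqEsubset; split => // x _.
  have [i _ Fi] : (\bigcup_i F i) (x ord0 ord0) by rewrite -FT.
  have [j _ Gj] : (\bigcup_j G j) (tail x) by rewrite -GT.
  by exists (pickle (i, j)) => //; rewrite pickleK.
move=> k; case: unpickle => [[i j]|]; last first.
  by split => //; rewrite measure0.
split => //; rewrite /cons_measure /pushforward.
have -> : @cons_cV n @^-1` A i j = F i `*` G j.
  rewrite /A predeqE => -[a v] /=.
  have -> : cons_cV (a, v) ord0 ord0 = a by rewrite mxE unlift_none.
  suff -> : tail (cons_cV (a, v)) = v by [].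
  by apply/colP => l; rewrite !mxE liftK.
have [mFi Fi] := mF i; have [mGj Gj] := mG j.
by rewrite product_measure1E // lte_mul_pinfty // ge0_fin_numE.
Qed.

HB.instance Definition _ := Measure_isSigmaFinite.Build _ _ _ cons_measure
  cm_sigma_finite.
End cons_measure.

(* the product measure m_0 (x) ... (x) m_(n-1) on R^n *)
Fixpoint product_measure n :
    ('I_n -> {sigma_finite_measure set (measurableTypeR R) -> \bar R}) ->
    {sigma_finite_measure set 'cV[R]_n -> \bar R} :=
  if n is n'.+1 then fun m =>
    cons_measure (m ord0) (product_measure (fun i : 'I_n' => m (lift ord0 i)))
  else fun=> \d_((0%R : 'cV[R]_0)).

Lemma product_measure_box n
    (m : 'I_n -> {sigma_finite_measure set (measurableTypeR R) -> \bar R})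
    (A : 'I_n -> set (measurableTypeR R)) : (forall i, measurable (A i)) ->
  product_measure m [set x | forall i, A i (x i ord0)] = \prod_(i < n) m i (A i).
Proof.
elim: n m A => [|n IH] m A mA /=.
  rewrite big_ord0 diracE mem_set //.
  by case.
rewrite big_ord_recl -IH // /cons_measure /pushforward.
rewrite -product_measure1E //; last first.
  by apply: (measurable_box (A := fun i => A (lift ord0 i))).
congr (_ _); apply/seteqP; split => -[a v] /=.
  move=> H; split; first by have := H ord0; rewrite mxE unlift_none.
  by move=> i; have := H (lift ord0 i); rewrite mxE liftK.
move=> [Aa Av] i; rewrite mxE.
by case: unliftP => [j ->|->] //=; exact: Av.
Qed.
End product_measure_cV.

Section weak_gradient.
Context {R : realType} {d : nat}.
Implicit Types (Om K : set 'cV[R]_d) (f phi : 'cV[R]_d -> R)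
  (g : 'cV[R]_d -> 'cV[R]_d).

Definition lebesgue_cV : {sigma_finite_measure set 'cV[R]_d -> \bar R} :=
  product_measure (fun _ : 'I_d => @lebesgue_measure R).

Definition partial (i : 'I_d) phi : 'cV[R]_d -> R :=
  fun x => 'D_(delta_mx i ord0) phi x.

Definition smooth phi := forall s : seq 'I_d,
  continuous (foldr partial phi s) /\
  forall i x, derivable (foldr partial phi s) x (delta_mx i ord0).

(* phi \in C_c^oo(Om) *)
Definition test_function Om phi := smooth phi /\
  exists K, [/\ compact K, K `<=` Om & forall x, ~ K x -> phi x = 0].

Definition loc_integrable Om f := measurable_fun Om f /\
  forall K, compact K -> K `<=` Om -> lebesgue_cV.-integrable K (EFin \o f).

Definition weak_gradient Om f g := [/\ loc_integrable Om f,
  forall i, loc_integrable Om (fun x => g x i ord0) &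
  forall phi, test_function Om phi -> forall i,
    \int[lebesgue_cV]_(x in Om) (f x * partial i phi x) =
    - \int[lebesgue_cV]_(x in Om) (g x i ord0 * phi x)].

Lemma measurable_compact_cV K : compact K -> measurable K.
Proof.
move=> cK; rewrite -[K]setCK; apply: measurableC.
apply: measurable_open_cV; apply: closed_openC.
exact: compact_closed (@norm_hausdorff _ _) cK.
Qed.

Lemma integrableM_compact Om K f phi : compact K -> K `<=` Om ->
  measurable Om -> loc_integrable Om f -> continuous phi -> (forall x, ~ K x -> phi x = 0) ->
  lebesgue_cV.-integrable Om (EFin \o (fun x => f x * phi x)).
Proof.
move=> cK KO mOm [mf If] cphi phi0; have mK := measurable_compact_cV cK.
have [M M0 phiM] : exists2 M : R, 0 < M & forall x, `|phi x| <= M.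
  have /compact_bounded[M [_ HM]] : compact (phi @` K).
    by apply: continuous_compact => //; exact: continuous_subspaceT.
  exists (Num.max (M + 1) 1); first by rewrite lt_max ltr01 orbT.
  move=> x; have [Kx|nKx] := pselect (K x).
    by rewrite le_max; apply/orP; left; apply: (HM (M + 1)); [rewrite ltrDl|exists x].
  by rewrite phi0 // normr0 le_max ler01 orbT.
have mphi := continuous_measurable_cV cphi.
have mOm_fphi : measurable_fun Om (EFin \o (fun x => f x * phi x)).
  apply/measurable_EFinP; apply: measurable_funM => //.
  exact: measurable_funTS.
have IK : lebesgue_cV.-integrable K (EFin \o (fun x => f x * phi x)).
  apply: (le_integrable mK _ _ (integrableZl mK M (If K cK KO))).
    exact: measurable_funS mOm KO mOm_fphi.
  move=> x _ /=; rewrite lee_fin !normrM mulrC ler_wpM2r //.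
  by rewrite (gtr0_norm M0).
apply/(integrable_mkcond _ mOm).
rewrite (_ : _ \_ Om = (EFin \o (fun x => f x * phi x)) \_ K).
  exact/(integrable_mkcond _ mK).
apply/funext => x; rewrite !patchE.
have [Kx|nKx] := pselect (K x); first by rewrite !mem_set //; exact: KO.
by rewrite (memNset nKx); case: ifP => //= _; rewrite phi0 // mulr0.
Qed.

Lemma partial_support K phi i : compact K -> (forall x, ~ K x -> phi x = 0) ->
  forall x, ~ K x -> partial i phi x = 0.
Proof.
move=> cK phi0 x nKx; rewrite /partial.
have oK : open (~` K).
  by apply: closed_openC; exact: compact_closed (@norm_hausdorff _ _) cK.
rewrite -(@derive_cst R 'cV[R]_d R (0 : R) x (delta_mx i ord0)).
apply: near_eq_derive; near=> y; apply: phi0; near: y.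
exact: open_nbhs_nbhs.
Unshelve. all: by end_near. Qed.

Lemma weak_gradientB Om f1 f2 g1 g2 : open Om ->
  weak_gradient Om f1 g1 -> weak_gradient Om f2 g2 ->
  weak_gradient Om (f1 \- f2) (g1 \- g2).
Proof.
move=> oOm [If1 Ig1 w1] [If2 Ig2 w2]; have mOm := measurable_open_cV oOm.
have loc_integrableB h1 h2 : loc_integrable Om h1 -> loc_integrable Om h2 ->
    loc_integrable Om (fun x => h1 x - h2 x).
  move=> [m1 I1] [m2 I2]; split; first exact: measurable_funB.
  move=> K cK KO; have mK := measurable_compact_cV cK.
  exact: (integrableB mK (I1 K cK KO) (I2 K cK KO)).
split => [|i|phi tphi i].
- exact: loc_integrableB.
- rewrite (_ : (fun _ => _) = (fun x => g1 x i ord0 - g2 x i ord0)).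
    exact: loc_integrableB.
  by apply/funext => x; rewrite !mxE.
- have [sphi [K [cK KO phi0]]] := tphi.
  have I f h : loc_integrable Om f -> continuous h ->
      (forall x, ~ K x -> h x = 0) ->
      lebesgue_cV.-integrable Om (EFin \o (fun x => f x * h x)).
    by move=> If ch h0; exact: integrableM_compact h0.
  have cphi : continuous phi by have [] := sphi [::].
  have cdphi : continuous (partial i phi) by have [] := sphi [:: i].
  have dphi0 := partial_support i cK phi0.
  under eq_Rintegral do rewrite /= mulrBl.
  under [in RHS]eq_Rintegral do rewrite /= !mxE mulrBl.
  rewrite !RintegralB //; try exact: I.
  by rewrite w1 // w2 // opprD.
Qed.

End weak_gradient.

Section gradient_covariance.
Context {R : realType} {d : nat}.
Implicit Types (Om : set 'cV[R]_d) (g : 'cV[R]_d -> 'cV[R]_d)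
  (mu : {measure set 'cV[R]_d -> \bar R}).

Definition product_domain (I : 'I_d -> set R) : set 'cV[R]_d :=
  [set x | forall i, I i (x i ord0)].

(* The library norm on matrices is the max norm, hence this definition. *)
Definition norm2 n (v : 'cV[R]_n) : R := Num.sqrt (\sum_i v i ord0 ^+ 2).

Definition opnorm m n (A : 'M[R]_(m, n)) : R :=
  sup [set norm2 (A *m v) | v in [set v : 'cV[R]_n | norm2 v <= 1]].

Definition L2_field mu Om g := measurable_fun Om g /\
  mu.-integrable Om (fun x => (norm2 (g x) ^+ 2)%:E).

Definition L2_norm mu Om g : R :=
  Num.sqrt (\int[mu]_(x in Om) (norm2 (g x) ^+ 2)).

Definition grad_cov mu Om g : 'M[R]_d :=
  \matrix_(i, j) \int[mu]_(x in Om) (g x *m (g x)^T) i j.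

Definition empirical_cov N g (x : 'I_N -> 'cV[R]_d) : 'M[R]_d :=
  N%:R^-1 *: \sum_(n < N) g (x n) *m (g (x n))^T.

(* eigenvalues with multiplicity, in nonincreasing order *)
Definition eigenvalues (A : 'M[R]_d) (nu : d.-tuple R) :=
  char_poly A = \prod_(x <- nu) ('X - x%:P) /\ sorted >=%O nu.

(* The columns of W are an orthonormal basis of the span of r orthonormal
   eigenvectors of A (the first r columns of V) for its r largest eigenvalues.
   Without a gap after the r-th eigenvalue this span is not unique; every
   choice is then allowed. *)
Definition leading_eigenbasis r (A : 'M[R]_d) (W : 'M[R]_(d, r)) :=
  W^T *m W = 1%:M /\
  exists (V : 'M[R]_d) (lam : 'rV[R]_d),
    [/\ V^T *m V = 1%:M, A *m V = V *m diag_mx lam,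
        forall i j : 'I_d, (i <= j)%N -> lam ord0 j <= lam ord0 i &
        (W^T == (V *m (pid_mx r : 'M[R]_(d, r)))^T)%MS].

Definition singular_values m n (A : 'M[R]_(m, n)) (s : 'rV[R]_n) :=
  (forall i, 0 <= s ord0 i) /\
  char_poly (A^T *m A) = \prod_i ('X - (s ord0 i ^+ 2)%:P).

(* principal angles between the column spaces of W1 and W2, which are assumed
   to have orthonormal columns *)
Definition principal_angles r (W1 W2 : 'M[R]_(d, r)) (theta : 'rV[R]_r) :=
  exists2 s : 'rV[R]_r, singular_values (W1^T *m W2) s & theta = map_mx acos s.

Definition sin_Theta r (theta : 'rV[R]_r) : 'M[R]_r :=
  diag_mx (map_mx sin theta).

(* X_0, ..., X_(N-1) have law mu, and theta, X_0, ..., X_(N-1) are mutually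
   independent: given theta, the X_n are i.i.d. with law mu. *)
Definition iid_given dS dT (S : measurableType dS) (T : measurableType dT)
    (P : probability S R) (mu : set 'cV[R]_d -> \bar R) (theta : S -> T) N
    (X : 'I_N -> S -> 'cV[R]_d) :=
  [/\ measurable_fun [set: S] theta,
      forall n, measurable_fun [set: S] (X n) &
      forall (B : set T) (A : 'I_N -> set 'cV[R]_d),
        measurable B -> (forall n, measurable (A n)) ->
        P [set w | B (theta w) /\ forall n, A n (X n w)] =
        (P (theta @^-1` B) * \prod_(n < N) mu (A n))%E].

End gradient_covariance.

(* Main.v *)
(* Davis-Kahan: if [w] is an eigenvector of [(What^T W)^T (What^T W)] with
   eigenvalue [cos^2 theta], then comparing the quadratic forms of [Cu] and
   [Chat] on [W w] and on its component orthogonal to the range of [What] gives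
   [sin theta * (nu_(r-1) - lamh_r) <= |Chat - Cu|], and by Weyl's inequality the
   gap on the left is at least [Delta / 2].

   Concentration: the method of moments avoids both the matrix exponential and
   the spectral theorem. Let [Z] be a sum of independent centered symmetric
   matrices [Y_i] with [|Y_i| <= L], and [Z_i := Z - Y_i]. Since
   [E tr (Y_i Z_i^(2p-1)) = 0], telescoping [Z^(2p-1) - Z_i^(2p-1)] writes
   [E tr Z^(2p)] as a sum of terms [E tr (Y_i Z^q Y_i Z_i^(2p-2-q))], each at most
   [L^2 E (tr Z^(2p-2) + tr Z_i^(2p-2))] by log-convexity in [q]. By induction
   [E tr Z^(2p) <= d (4 p N L^2)^p], and Markov's inequality for [p] close to
   [ln (d / eta)] gives the tail bound.

   The gradient, only almost surely bounded, is first truncated. Independence of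
   [Y_i] from [Z_i] is expressed on the sigma-algebra generated by [theta] and
   the [X_j] with [j != i]. *)
Require Import Defs.
From HB Require Import structures.
From mathcomp Require Import all_boot all_order all_algebra.
From mathcomp Require Import all_classical all_reals all_analysis.
From mathcomp Require Import measurable_realfun ring lra zify.

Set Implicit Arguments.
Unset Strict Implicit.
Unset Printing Implicit Defensive.

Import Order.TTheory GRing.Theory Num.Theory.
Import numFieldNormedType.Exports.

Local Open Scope classical_set_scope.
Local Open Scope ring_scope.

(** * Euclidean and operator norms *)

Section euclidean.
Context {R : realType}.

(** The discriminant argument behind Cauchy-Schwarz, with abstract coefficients so that it serves
    both [dotv] and the [L2_norm] of fields. *)
Lemma le_sqrtM_of_quad (a b c : R) :
  (forall s t, 0 <= s ^+ 2 * a - 2 * (s * t) * b + t ^+ 2 * c) ->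
  b <= Num.sqrt a * Num.sqrt c.
Proof.
move=> H; have a0 : 0 <= a by have := H 1 0; lra.
have c0 : 0 <= c by have := H 0 1; lra.
have [|b0] := leP b 0.
  by move=> /le_trans; apply; rewrite mulr_ge0 ?sqrtr_ge0.
rewrite -sqrtrM // -[b]gtr0_norm // -sqrtr_sqr ler_wsqrtr //.
have [c1|c1] := ltP 0 c.
  have := H c b; have -> : c ^+ 2 * a - 2 * (c * b) * b + b ^+ 2 * c =
    c * (a * c - b ^+ 2) by ring.
  by rewrite pmulr_rge0 // subr_ge0.
have ce : c = 0 by apply/eqP; rewrite eq_le c0 c1.
(* For [c = 0] the form is affine in [t]; this [t] gives it the value [-1], which is absurd. *)
have := H 1 ((a + 1) / (2 * b)); rewrite ce.
have -> : 1 ^+ 2 * a - 2 * (1 * ((a + 1) / (2 * b))) * b +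
  ((a + 1) / (2 * b)) ^+ 2 * 0 = - 1 by field; apply/lt0r_neq0.
lra.
Qed.

Definition dotv n (u v : 'cV[R]_n) : R := \sum_i u i ord0 * v i ord0.

Lemma dotvE n (u v : 'cV[R]_n) : dotv u v = (u^T *m v) ord0 ord0.
Proof. by rewrite mxE; apply: eq_bigr => i _; rewrite mxE. Qed.

Lemma mulmx_trE n (v : 'cV[R]_n) i j :
  (v *m v^T) i j = v i ord0 * v j ord0.
Proof. by rewrite mxE big_ord1 mxE. Qed.

Lemma dotvC n (u v : 'cV[R]_n) : dotv u v = dotv v u.
Proof. by apply: eq_bigr => i _; rewrite mulrC. Qed.

Lemma dotvDr n (u v w : 'cV[R]_n) : dotv u (v + w) = dotv u v + dotv u w.
Proof. by rewrite !dotvE mulmxDr mxE. Qed.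

Lemma dotvBr n (u v w : 'cV[R]_n) : dotv u (v - w) = dotv u v - dotv u w.
Proof. by rewrite !dotvE mulmxBr !mxE. Qed.

Lemma dotvDl n (u v w : 'cV[R]_n) : dotv (u + v) w = dotv u w + dotv v w.
Proof. by rewrite ![dotv _ w]dotvC dotvDr. Qed.

Lemma dotvBl n (u v w : 'cV[R]_n) : dotv (u - v) w = dotv u w - dotv v w.
Proof. by rewrite ![dotv _ w]dotvC dotvBr. Qed.

Lemma dotvZr n a (u v : 'cV[R]_n) : dotv u (a *: v) = a * dotv u v.
Proof. by rewrite !dotvE -scalemxAr mxE. Qed.

Lemma dotvZl n a (u v : 'cV[R]_n) : dotv (a *: u) v = a * dotv u v.
Proof. by rewrite dotvC dotvZr dotvC. Qed.

Lemma dotv_mulmxr m n (A : 'M[R]_(m, n)) u v :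
  dotv u (A *m v) = dotv (A^T *m u) v.
Proof. by rewrite !dotvE trmx_mul trmxK mulmxA. Qed.

Lemma dotv_mulmxl m n (A : 'M[R]_(m, n)) u v :
  dotv (A *m u) v = dotv u (A^T *m v).
Proof. by rewrite dotvC dotv_mulmxr dotvC. Qed.

Lemma dotvv_ge0 n (v : 'cV[R]_n) : 0 <= dotv v v.
Proof. by apply: sumr_ge0 => i _; rewrite -expr2 sqr_ge0. Qed.

Lemma dotvv_eq0 n (v : 'cV[R]_n) : (dotv v v == 0) = (v == 0).
Proof.
apply/idP/eqP => [|->]; last by rewrite /dotv big1 // => i _; rewrite mxE mul0r.
rewrite psumr_eq0 => [/allP v0|i _]; last by rewrite -expr2 sqr_ge0.
apply/colP => i; rewrite mxE.
by have := v0 i (mem_index_enum _); rewrite /= mulf_eq0 orbb => /eqP.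
Qed.

Lemma norm2E n (v : 'cV[R]_n) : norm2 v = Num.sqrt (dotv v v).
Proof. by congr Num.sqrt; apply: eq_bigr => i _; rewrite expr2. Qed.

Lemma norm2_ge0 n (v : 'cV[R]_n) : 0 <= norm2 v.
Proof. exact: sqrtr_ge0. Qed.

Lemma sqr_norm2 n (v : 'cV[R]_n) : norm2 v ^+ 2 = dotv v v.
Proof. by rewrite norm2E sqr_sqrtr // dotvv_ge0. Qed.

Lemma norm2_eq0 n (v : 'cV[R]_n) : (norm2 v == 0) = (v == 0).
Proof. by rewrite -dotvv_eq0 -sqr_norm2 expf_eq0. Qed.

Lemma norm2_0 n : norm2 (0 : 'cV[R]_n) = 0.
Proof. by apply/eqP; rewrite norm2_eq0. Qed.

Lemma norm2Z n a (v : 'cV[R]_n) : norm2 (a *: v) = `|a| * norm2 v.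
Proof.
by rewrite !norm2E dotvZl dotvZr mulrA -expr2 sqrtrM ?sqr_ge0 // sqrtr_sqr.
Qed.

Lemma dotv_le n (u v : 'cV[R]_n) : dotv u v <= norm2 u * norm2 v.
Proof.
rewrite !norm2E; apply: le_sqrtM_of_quad => s t.
suff -> : s ^+ 2 * dotv u u - 2 * (s * t) * dotv u v + t ^+ 2 * dotv v v =
  dotv (s *: u - t *: v) (s *: u - t *: v) by exact: dotvv_ge0.
by rewrite dotvBl !dotvBr !dotvZl !dotvZr (dotvC v u); ring.
Qed.

Lemma ler_norm_dotv n (u v : 'cV[R]_n) : `|dotv u v| <= norm2 u * norm2 v.
Proof.
rewrite ler_norml dotv_le andbT lerNl.
have -> : - dotv u v = dotv (-1 *: u) v by rewrite dotvZl mulN1r.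
by apply: (le_trans (dotv_le _ _)); rewrite norm2Z normrN1 mul1r.
Qed.

Lemma ler_norm2D n (u v : 'cV[R]_n) : norm2 (u + v) <= norm2 u + norm2 v.
Proof.
rewrite -(ler_pXn2r (n := 2)) ?nnegrE ?addr_ge0 ?norm2_ge0 //.
rewrite sqr_norm2 dotvDl !dotvDr (dotvC v u).
have := dotv_le u v; rewrite -!sqr_norm2; nra.
Qed.

Lemma norm2_sum_le n I (s : seq I) (F : I -> 'cV[R]_n) :
  norm2 (\sum_(i <- s) F i) <= \sum_(i <- s) norm2 (F i).
Proof.
elim: s => [|i s IH]; first by rewrite !big_nil le_eqVlt norm2_eq0 eqxx.
by rewrite !big_cons (le_trans (ler_norm2D _ _)) // lerD2l.
Qed.

Lemma norm_coord_le n (v : 'cV[R]_n) i : `|v i ord0| <= norm2 v.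
Proof.
rewrite -sqrtr_sqr norm2E ler_wsqrtr // /dotv (bigD1 i) //= -expr2 lerDl.
by apply: sumr_ge0 => j _; rewrite -expr2 sqr_ge0.
Qed.

Lemma norm2_delta n i : norm2 (delta_mx i ord0 : 'cV[R]_n) = 1.
Proof.
rewrite norm2E /dotv (bigD1 i) //= big1 => [|j ji].
  by rewrite !mxE !eqxx mul1r addr0 sqrtr1.
by rewrite !mxE (negbTE ji) mul0r.
Qed.

(** A crude bound by column norms. It makes the set in [opnorm] bounded above, without which [sup]
    would be a default value, and serves as Lipschitz constant in [opnorm_le_rat]. *)
Lemma norm2_mulmx_bounded m n (A : 'M[R]_(m, n)) :
  exists2 M : R, 0 <= M & forall v, norm2 (A *m v) <= M * norm2 v.
Proof.
exists (\sum_j norm2 (col j A)).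
  by apply: sumr_ge0 => j _; exact: norm2_ge0.
move=> v; have -> : A *m v = \sum_j v j ord0 *: col j A.
  apply/colP => i; rewrite summxE mxE.
  by apply: eq_bigr => j _; rewrite !mxE mulrC.
rewrite (le_trans (norm2_sum_le _ _)) // mulr_suml ler_sum // => j _.
by rewrite norm2Z mulrC ler_wpM2l ?norm2_ge0 ?norm_coord_le.
Qed.

Lemma norm2_mulmx_le m n (A : 'M[R]_(m, n)) v :
  norm2 (A *m v) <= opnorm A * norm2 v.
Proof.
have [->|v0] := eqVneq v 0.
  by rewrite mulmx0 !norm2_0 mulr0.
have nv0 : 0 < norm2 v by rewrite lt_neqAle norm2_ge0 eq_sym norm2_eq0 v0.
rewrite -ler_pdivrMr //; have [M M0 HM] := norm2_mulmx_bounded A.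
apply: (@ub_le_sup R).
  exists M => _ [w /= w1 <-]; apply: (le_trans (HM w)).
  by rewrite -[leRHS]mulr1 ler_wpM2l.
exists ((norm2 v)^-1 *: v) => /=.
  by rewrite norm2Z ger0_norm ?invr_ge0 ?norm2_ge0 // mulVf // gt_eqF.
by rewrite -scalemxAr norm2Z ger0_norm ?invr_ge0 ?norm2_ge0 // mulrC.
Qed.

Lemma opnorm_le m n (A : 'M[R]_(m, n)) (M : R) : 0 <= M ->
  (forall v, norm2 (A *m v) <= M * norm2 v) -> opnorm A <= M.
Proof.
move=> M0 HM; apply: sup_le_ub.
  exists (norm2 (A *m 0)), 0 => //=.
  by rewrite norm2_0.
move=> _ [w /= w1 <-]; apply: (le_trans (HM w)).
by rewrite -[leRHS]mulr1 ler_wpM2l.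
Qed.

Lemma opnorm_ge0 m n (A : 'M[R]_(m, n)) : 0 <= opnorm A.
Proof.
have [M M0 HM] := norm2_mulmx_bounded A.
apply: (le_trans (norm2_ge0 (A *m 0))); apply: (@ub_le_sup R).
  exists M => _ [w /= w1 <-]; apply: (le_trans (HM w)).
  by rewrite -[leRHS]mulr1 ler_wpM2l.
by exists 0 => //=; rewrite norm2_0.
Qed.

Lemma opnormD m n (A B : 'M[R]_(m, n)) : opnorm (A + B) <= opnorm A + opnorm B.
Proof.
apply: opnorm_le; first by rewrite addr_ge0 ?opnorm_ge0.
move=> v; rewrite mulmxDl mulrDl (le_trans (ler_norm2D _ _)) //.
by rewrite lerD ?norm2_mulmx_le.
Qed.

Lemma dotv_opnorm_le m n (A : 'M[R]_(m, n)) u v :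
  `|dotv u (A *m v)| <= opnorm A * norm2 u * norm2 v.
Proof.
apply: (le_trans (ler_norm_dotv _ _)).
by rewrite mulrAC mulrC ler_wpM2r ?norm2_ge0 ?norm2_mulmx_le.
Qed.

Lemma opnorm_le_dotv m n (A : 'M[R]_(m, n)) (M : R) : 0 <= M ->
  (forall u v, dotv u (A *m v) <= M * norm2 u * norm2 v) -> opnorm A <= M.
Proof.
move=> M0 HM; apply: opnorm_le => // v.
(* Testing with [u = A *m v] bounds the square of [norm2 (A *m v)]; one factor cancels. *)
have := HM (A *m v) v; rewrite -sqr_norm2 expr2.
have [->|n0] := eqVneq (norm2 (A *m v)) 0.
  by move=> _; rewrite mulr_ge0 // norm2_ge0.
by rewrite mulrAC ler_pM2r // lt_neqAle norm2_ge0 eq_sym n0.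
Qed.

End euclidean.

(** * The Davis-Kahan theorem *)

Section davis_kahan.
Context {R : realType}.

Lemma mul_pid_mx_coord d r (x : 'cV[R]_d) i :
  ((pid_mx r : 'M[R]_d) *m x) i ord0 = (i < r)%N%:R * x i ord0.
Proof.
rewrite mxE (bigD1 i) //= big1 ?addr0 => [|j ji].
  by rewrite mxE eqxx.
by rewrite mxE eq_sym (negbTE (_ : j != i :> nat)) ?mul0r.
Qed.

Lemma orthogonal_dotv d (V : 'M[R]_d) (x y : 'cV[R]_d) : V^T *m V = 1%:M ->
  dotv (V^T *m x) (V^T *m y) = dotv x y.
Proof. by move/mulmx1C => VV; rewrite dotv_mulmxl mulmxA trmxK VV mul1mx. Qed.

Lemma dotv_diag d (V : 'M[R]_d) (lam : 'rV[R]_d) (x y : 'cV[R]_d) :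
  dotv x (V *m diag_mx lam *m V^T *m y) =
  \sum_i lam ord0 i * ((V^T *m x) i ord0 * (V^T *m y) i ord0).
Proof.
rewrite -!mulmxA dotv_mulmxr; apply: eq_bigr => i _.
by rewrite mul_diag_mx [X in _ * X]mxE mulrCA.
Qed.

Lemma char_poly_orthogonal_diag d (V : 'M[R]_d) (lam : 'rV[R]_d) :
  V^T *m V = 1%:M ->
  char_poly (V *m diag_mx lam *m V^T) = \prod_i ('X - (lam ord0 i)%:P).
Proof.
move=> VV; have VV' := mulmx1C VV.
have -> : \prod_i ('X - (lam ord0 i)%:P) = char_poly (diag_mx lam).
  rewrite char_poly_trig ?diag_mx_is_trig //.
  by apply: eq_bigr => i _; rewrite mxE eqxx mulr1n.
rewrite /char_poly /char_poly_mx !map_mxM /=.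
set V' := map_mx polyC V; set D := map_mx polyC (diag_mx lam).
have VVp : V' *m map_mx polyC V^T = 1%:M by rewrite -map_mxM /= VV' map_mx1.
have -> : 'X%:M - V' *m D *m map_mx polyC V^T =
    V' *m ('X%:M - D) *m map_mx polyC V^T.
  by rewrite mulmxBr mulmxBl scalar_mxC -(mulmxA _ V') VVp mulmx1.
by rewrite !det_mulmx mulrAC -det_mulmx VVp det1 mul1r.
Qed.

(** Sorted root lists of the same polynomial coincide, so every sorted orthonormal eigenbasis
    reproduces [nu] in order. *)
Lemma eigenvalues_orthogonal_diag d (V : 'M[R]_d) (lam : 'rV[R]_d)
    (nu : d.-tuple R) :
  V^T *m V = 1%:M -> (forall i j : 'I_d, (i <= j)%N -> lam ord0 j <= lam ord0 i) ->
  eigenvalues (V *m diag_mx lam *m V^T) nu ->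
  forall i : 'I_d, lam ord0 i = nu`_i.
Proof.
move=> VV slam [cnu snu] i.
pose l := codom (fun j => lam ord0 j).
have pl : \prod_(x <- l) ('X - x%:P) = \prod_(x <- nu) ('X - x%:P).
  by rewrite -cnu char_poly_orthogonal_diag // big_map big_enum.
have sl : sorted >=%R l.
  rewrite sorted_map; apply: (sub_sorted (e := relpre val leq)).
    by move=> j k /= /slam.
  by rewrite -sorted_map val_enum_ord iota_sorted.
rewrite -(sorted_eq ge_trans ge_anti sl snu (prod_XsubC_eq pl)).
by rewrite (nth_map i) ?size_enum_ord // nth_ord_enum.
Qed.

(* The span of the first [r] eigenvectors meets the orthogonal complement of
   the span of any [r - 1] vectors. *)
Lemma weyl_le d (V Vh : 'M[R]_d) (lam lamh : 'rV[R]_d) (r : 'I_d) :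
  let A := V *m diag_mx lam *m V^T in
  let B := Vh *m diag_mx lamh *m Vh^T in
  V^T *m V = 1%:M -> Vh^T *m Vh = 1%:M ->
  (forall i j : 'I_d, (i <= j)%N -> lam ord0 j <= lam ord0 i) ->
  (forall i j : 'I_d, (i <= j)%N -> lamh ord0 j <= lamh ord0 i) ->
  lamh ord0 r <= lam ord0 r + opnorm (B - A).
Proof.
move=> A B VV VVh sl slh.
pose C : 'M[R]_(r.+1, d) := (pid_mx r.+1 : 'M[R]_(r.+1, d)) *m Vh^T.
(* With indices from [0]: [z] parametrizes the span of the first [r.+1] eigenvectors of [B], and
   orthogonality to the first [r] of [A] is [r] equations in [r.+1] unknowns. *)
have [z zn zC] : exists2 z : 'rV[R]_r.+1, z != 0 &
    z *m (C *m V *m (pid_mx r : 'M[R]_(d, r))) = 0.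
  set M := _ *m _; exists (nz_row (kermx M)).
    rewrite nz_row_eq0 -mxrank_eq0 mxrank_ker subn_eq0 -ltnNge ltnS.
    exact: rank_leq_col.
  by apply/sub_kermxP; exact: nz_row_sub.
pose x : 'cV[R]_d := (z *m C)^T.
have xV (i : 'I_d) : (i < r)%N -> (V^T *m x) i ord0 = 0.
  move=> ir; rewrite /x -trmx_mul mxE -mulmxA.
  have <- : (z *m (C *m V *m (pid_mx r : 'M[R]_(d, r)))) ord0 (Ordinal ir) =
      (z *m (C *m V)) ord0 i.
    rewrite mulmxA mxE (bigD1 i) //= big1 => [|j ji].
      by rewrite [X in _ * X]mxE /= eqxx ir mulr1 addr0.
    by rewrite [X in _ * X]mxE /= (negbTE (_ : j != i :> nat)) ?mulr0.
  by rewrite zC mxE.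
have xVh : Vh^T *m x = (pid_mx r.+1 : 'M[R]_(d, r.+1)) *m z^T.
  by rewrite /x /C !trmx_mul trmxK !mulmxA VVh mul1mx tr_pid_mx.
have xVh0 (i : 'I_d) : (r < i)%N -> (Vh^T *m x) i ord0 = 0.
  move=> ri; rewrite xVh mxE big1 // => j _.
  by rewrite mxE ltnNge ri andbF mul0r.
have x0 : x != 0.
  apply: contra_neq zn => x0; apply: trmx_inj; rewrite trmx0.
  have := congr1 (mulmx (pid_mx r.+1 : 'M[R]_(r.+1, d))) xVh.
  rewrite x0 !mulmx0 mulmxA mul_pid_mx !minnn (minn_idPr (ltn_ord r)).
  by rewrite pid_mx_1 mul1mx.
have xx : 0 < dotv x x by rewrite lt_neqAle dotvv_ge0 eq_sym dotvv_eq0 x0.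
(* On this [x] the form of [A] involves only eigenvalues of index at least [r], that of [B] only
   those of index at most [r]. *)
have HA : dotv x (A *m x) <= lam ord0 r * dotv x x.
  rewrite /A dotv_diag -(orthogonal_dotv x x VV) /dotv mulr_sumr ler_sum // => i _.
  have [ir|ri] := ltnP i r; first by rewrite xV // !mul0r !mulr0.
  by rewrite ler_wpM2r ?sl // -expr2 sqr_ge0.
have HB : lamh ord0 r * dotv x x <= dotv x (B *m x).
  rewrite /B dotv_diag -(orthogonal_dotv x x VVh) /dotv mulr_sumr ler_sum // => i _.
  have [ri|ir] := ltnP r i; first by rewrite xVh0 // !mul0r !mulr0.
  by rewrite ler_wpM2r ?slh // -expr2 sqr_ge0.
rewrite -(ler_pM2r xx) mulrDl (le_trans HB) // -lerBlDl.
apply: (@le_trans _ _ (dotv x ((B - A) *m x))).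
  by rewrite mulmxBl dotvBr lerD2l lerN2.
apply: (le_trans (ler_norm _)); apply: (le_trans (dotv_opnorm_le _ _ _)).
by rewrite -mulrA -expr2 sqr_norm2.
Qed.

(** [W] is one basis among many of its span, so it is described by coordinates in an eigenbasis [V]:
    those of index at least [r] vanish on its range, the first [r] on the orthogonal complement. *)
Lemma leading_eigenbasisP d r (A : 'M[R]_d) (W : 'M[R]_(d, r)) :
  leading_eigenbasis A W -> exists (V : 'M[R]_d) (lam : 'rV[R]_d),
  [/\ V^T *m V = 1%:M, A = V *m diag_mx lam *m V^T,
      forall i j : 'I_d, (i <= j)%N -> lam ord0 j <= lam ord0 i,
      forall x : 'cV[R]_d, (exists z, x = W *m z) <->
        forall i : 'I_d, (r <= i)%N -> (V^T *m x) i ord0 = 0 &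
      forall x : 'cV[R]_d, W^T *m x = 0 ->
        forall i : 'I_d, (i < r)%N -> (V^T *m x) i ord0 = 0].
Proof.
move=> [WW [V [lam [VV AV sl WV]]]]; exists V, lam.
have VV' := mulmx1C VV.
have span (x : 'cV[R]_d) : (exists z, x = W *m z) <->
        forall i : 'I_d, (r <= i)%N -> (V^T *m x) i ord0 = 0.
  split.
    move=> [z xz] i ri.
    have /submxP[D xD] : (x^T <= (V *m (pid_mx r : 'M[R]_(d, r)))^T)%MS.
      by rewrite -(eqmxP WV) xz trmx_mul submxMl.
    have -> : x = V *m (pid_mx r : 'M[R]_(d, r)) *m D^T.
      by rewrite -[LHS]trmxK xD trmx_mul trmxK.
    rewrite !mulmxA VV mul1mx mxE big1 // => j _.
    by rewrite mxE ltnNge ri andbF mul0r.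
  move=> Vx0.
  have /submxP[D xD] : (x^T <= W^T)%MS.
    rewrite (eqmxP WV).
    have -> : x = V *m (pid_mx r : 'M[R]_(d, r)) *m
                 ((pid_mx r : 'M[R]_(r, d)) *m (V^T *m x)).
      rewrite !mulmxA -(mulmxA V) pid_mx_id // -!mulmxA.
      rewrite -[LHS]mul1mx -VV' -mulmxA; congr (_ *m _); apply/colP => i.
      rewrite mul_pid_mx_coord; have [ir|ri] := ltnP i r; first by rewrite mul1r.
      by rewrite Vx0 // mulr0.
    by rewrite trmx_mul submxMl.
  by exists D^T; rewrite -[LHS]trmxK xD trmx_mul trmxK.
split => //; first by rewrite -AV -mulmxA VV' mulmx1.
move=> x Wx i ir.
(* The [i]-th eigenvector lies in the range of [W], so [x], orthogonal to that range, has no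
   component along it. *)
have [z ez] : exists z, V *m (delta_mx i ord0 : 'cV[R]_d) = W *m z.
  apply/span => j rj; rewrite mulmxA VV mul1mx mxE.
  by rewrite (negbTE (_ : j != i)) // -val_eqE gtn_eqF // (leq_trans ir).
have -> : (V^T *m x) i ord0 = dotv (delta_mx i ord0) (V^T *m x).
  rewrite /dotv (bigD1 i) //= big1 => [|j ji]; rewrite !mxE ?eqxx ?mul1r ?addr0 //.
  by rewrite (negbTE ji) mul0r.
rewrite -[V in V^T]trmxK trmxK -dotv_mulmxl ez dotv_mulmxl Wx.
by rewrite /dotv big1 // => j _; rewrite mxE mulr0.
Qed.

Lemma opnorm_diag_le n (D : 'rV[R]_n) (M : R) : 0 <= M ->
  (forall i, `|D ord0 i| <= M) -> opnorm (diag_mx D) <= M.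
Proof.
move=> M0 DM; apply: opnorm_le => // v.
rewrite -[M]ger0_norm // -norm2Z !norm2E ler_wsqrtr // ler_sum // => i _.
rewrite mul_diag_mx !mxE -!expr2 !exprMn ler_wpM2r ?sqr_ge0 //.
by rewrite -[leLHS]real_normK ?num_real // lerXn2r ?nnegrE.
Qed.

(* With [p = W w] for a singular vector [w] and [q] the component of [p]
   orthogonal to the range of [What], the number [dotv q ((A - B) p)] is at
   least [(1 - a) (nu_(r-1) - lamh_r) |w|^2], [1 - a] being the squared sine. *)
Lemma davis_kahan d r (A B : 'M[R]_d) (nu : d.-tuple R) (W What : 'M[R]_(d, r))
    (angles : 'rV[R]_r) :
  let Delta := nu`_r.-1 - nu`_r in
  (1 <= r < d)%N -> 0 < Delta -> eigenvalues A nu ->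
  opnorm (B - A) <= Delta / 2 ->
  leading_eigenbasis A W -> leading_eigenbasis B What ->
  principal_angles What W angles ->
  opnorm (sin_Theta angles) <= 2 / Delta * opnorm (B - A).
Proof.
move=> Delta /andP[r1 rd] D0 nuA eD lA lB [s [s0 sM] ->].
have e0 := opnorm_ge0 (B - A); set e := opnorm (B - A) in eD e0 *.
have WW : W^T *m W = 1%:M by case: lA.
have WWh : What^T *m What = 1%:M by case: lB.
have [V [lam [VV AE sl spanV _]]] := leading_eigenbasisP lA.
have [Vh [lamh [VVh BE slh spanVh orthVh]]] := leading_eigenbasisP lB.
have rd1 : (r.-1 < d)%N by rewrite (leq_ltn_trans _ rd) // leq_pred.
rewrite AE in nuA; have lamE := eigenvalues_orthogonal_diag VV sl nuA.
have weyl : lamh ord0 (Ordinal rd) <= nu`_r + e.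
  have := weyl_le (Ordinal rd) VV VVh sl slh; rewrite -AE -BE.
  by rewrite (lamE (Ordinal rd)).
have K0 : 0 <= 2 / Delta * e by rewrite mulr_ge0 ?divr_ge0 ?(ltW D0).
apply: opnorm_diag_le => // i.
rewrite !mxE.
set M := What^T *m W in sM; set a := s ord0 i ^+ 2.
(* [a] is a root of the characteristic polynomial; [eigenvalueP] yields a row vector, hence the
   transposition below. *)
have : eigenvalue (M^T *m M) a.
  rewrite eigenvalue_root_char sM /root horner_prod prodf_seq_eq0.
  apply/hasP; exists i; first by rewrite mem_index_enum.
  by rewrite /= !hornerE subrr.
move=> /eigenvalueP[w' Mw' w0']; pose w := w'^T.
have w0 : w != 0 by rewrite trmx_eq0.
have Mw : M^T *m (M *m w) = a *: w.
  apply: trmx_inj; rewrite (trmx_mul M^T) (trmx_mul M) [M^T^T]trmxK linearZ /=.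
  by rewrite [w^T]trmxK -Mw' -mulmxA.
have ww : 0 < dotv w w by rewrite lt_neqAle dotvv_ge0 eq_sym dotvv_eq0 w0.
pose p := W *m w; pose q := p - What *m (M *m w).
have Whq : What^T *m q = 0.
  by rewrite mulmxBr !mulmxA WWh mul1mx subrr.
have Wq : W^T *m q = (1 - a) *: w.
  rewrite mulmxBr !mulmxA WW mul1mx -!mulmxA scalerBl scale1r -Mw.
  by rewrite /M trmx_mul trmxK !mulmxA.
have pp : dotv p p = dotv w w by rewrite dotv_mulmxl mulmxA WW mul1mx.
have qWh z : dotv q (What *m z) = 0.
  by rewrite dotv_mulmxr Whq /dotv big1 // => j _; rewrite mxE mul0r.
have qq : dotv q q = (1 - a) * dotv w w.
  by rewrite {2}/q dotvBr qWh subr0 dotv_mulmxr Wq dotvZl.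
(* Up to the factor [dotv w w], [1 - a] is a squared norm; the cosine is thus at most [1] and
   [sin_acos] applies. *)
have a1 : 0 <= 1 - a by rewrite -(pmulr_lge0 _ ww) -qq dotvv_ge0.
have s1 : s ord0 i <= 1.
  rewrite -(ler_pXn2r (n := 2)) ?nnegrE // expr1n -subr_ge0 //.
rewrite sin_acos; last by rewrite s1 andbT (le_trans _ (s0 i)) // lerN10.
rewrite -/a ger0_norm ?sqrtr_ge0 //; set sg := Num.sqrt _.
have sg0 : 0 <= sg := sqrtr_ge0 _.
have sg2 : sg ^+ 2 = 1 - a by rewrite sqr_sqrtr.
have nq : norm2 q = sg * norm2 w by rewrite !norm2E qq sqrtrM.
have np : norm2 p = norm2 w by rewrite !norm2E pp.
(* The component of [p] in the range of [What] contributes nothing: in the eigenbasis of [B] its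
   coordinates and those of [q] have disjoint supports. *)
have HB : dotv q (B *m p) <= lamh ord0 (Ordinal rd) * ((1 - a) * dotv w w).
  have -> : p = q + What *m (M *m w) by rewrite subrK.
  rewrite mulmxDr dotvDr [X in _ + X](_ : _ = 0) ?addr0; last first.
    rewrite BE dotv_diag big1 // => j _; have [jr|rj] := ltnP j r.
      by rewrite (orthVh q) // mul0r mulr0.
    rewrite [X in _ * (_ * X)](_ : _ = 0) ?mulr0 //.
    by move: j rj; apply/spanVh; exists (M *m w).
  rewrite -qq -(orthogonal_dotv q q VVh) BE dotv_diag /dotv mulr_sumr ler_sum //.
  move=> j _; have [jr|rj] := ltnP j r.
    by rewrite (orthVh q) // !mul0r !mulr0.
  by rewrite ler_wpM2r ?slh // -expr2 sqr_ge0.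
have pV := (spanV p).1 (ex_intro _ w erefl).
(* [A] preserves the range of [W], and [W^T *m q] is [(1 - a) *: w]; what remains is the form of [A]
   at [p], a combination of the [r] leading eigenvectors. *)
have HA : (1 - a) * (nu`_r.-1 * dotv w w) <= dotv q (A *m p).
  have [z Apz] : exists z, A *m p = W *m z.
    apply/spanV => j rj; rewrite AE !mulmxA VV mul1mx -!mulmxA mul_diag_mx mxE.
    by rewrite pV // mulr0.
  rewrite Apz dotv_mulmxr Wq dotvZl ler_wpM2l //.
  have -> : dotv w z = dotv p (A *m p).
    by rewrite Apz dotv_mulmxl mulmxA WW mul1mx.
  rewrite AE dotv_diag -pp -(orthogonal_dotv p p VV) /dotv mulr_sumr ler_sum //.
  move=> j _; have [rj|jr] := leqP r j.
    by rewrite pV // !mul0r !mulr0.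
  rewrite ler_wpM2r // -?expr2 ?sqr_ge0 // -(lamE (Ordinal rd1)) sl //=.
  by rewrite -ltnS prednK.
have HE : dotv q (A *m p) - dotv q (B *m p) <= e * (sg * dotv w w).
  rewrite -dotvBr -mulmxBl -opprB mulNmx -[X in dotv q X]scaleN1r dotvZr mulN1r.
  rewrite (le_trans (ler_norm _)) // normrN (le_trans (dotv_opnorm_le _ _ _)) //.
  by rewrite nq np -mulrA -/e -mulrA -expr2 sqr_norm2.
(* Weyl leaves at least half of the gap. A factor [sg] stays on both sides until the case of a zero
   sine is set aside. *)
have key : sg * (sg * (Delta / 2)) <= sg * e.
  rewrite -(ler_pM2r ww).
  have : (1 - a) * (Delta / 2 * dotv w w) <= e * (sg * dotv w w).
    apply: le_trans HE; rewrite -sg2 in HA HB *.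
    have : sg ^+ 2 * dotv w w * lamh ord0 (Ordinal rd) <=
           sg ^+ 2 * dotv w w * (nu`_r + Delta / 2).
      by rewrite ler_wpM2l ?mulr_ge0 ?sqr_ge0 ?dotvv_ge0 // (le_trans weyl) ?lerD2l.
    move: HA HB; rewrite /Delta; lra.
  rewrite -sg2; lra.
have [->|sgn] := eqVneq sg 0; first by [].
have sgp : 0 < sg by rewrite lt_neqAle eq_sym sgn.
move: key; rewrite ler_pM2l // mulrA ler_pdivrMr // -ler_pdivlMr //.
by move=> /le_trans; apply; rewrite [leRHS]mulrAC [2 * e]mulrC.
Qed.

End davis_kahan.

(** * Traces of powers of symmetric matrices *)

Section trace_powers.
Context {R : realType} {n : nat}.
Implicit Types A B X Y Z M : 'M[R]_n.

Lemma tr_mulr A B : (A * B)^T = B^T * A^T.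
Proof. exact: trmx_mul. Qed.

Lemma trmx_sym_exp A k : A^T = A -> (A ^+ k)^T = A ^+ k.
Proof.
move=> sA; elim: k => [|k IH]; first by rewrite expr0; exact: trmx1.
by rewrite {1}exprS tr_mulr IH sA -exprSr.
Qed.

Lemma mxtraceC A B : \tr (A * B) = \tr (B * A).
Proof. exact: mxtrace_mulC. Qed.

Lemma mxtrace_gram M : \tr (M^T * M) = \sum_j dotv (col j M) (col j M).
Proof.
apply: eq_bigr => j _; rewrite -[_ * _]/(_ *m _) mxE.
by apply: eq_bigr => i _; rewrite !mxE.
Qed.

Lemma mxtrace_gram_ge0 M : 0 <= \tr (M^T * M).
Proof. by rewrite mxtrace_gram sumr_ge0 // => j _; exact: dotvv_ge0. Qed.

Lemma mxtrace_gram_amgm M N :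
  2 * \tr (M^T * N) <= \tr (M^T * M) + \tr (N^T * N).
Proof.
have := mxtrace_gram_ge0 (M - N).
have -> : \tr ((M - N)^T * (M - N)) =
    \tr (M^T * M) - \tr (M^T * N) - (\tr (N^T * M) - \tr (N^T * N)).
  by rewrite linearB /= mulrBl !mulrBr !linearB.
have -> : \tr (N^T * M) = \tr (M^T * N).
  by rewrite -mxtrace_tr tr_mulr trmxK.
by lra.
Qed.

(** Induction on the right end: were [h m] above both [h 0] and [h m.+1], then [h m.-1 <= h m] by
    induction, and convexity at [m] would force [h m <= h m.+1]. *)
Lemma midpoint_convex_le_max (h : nat -> R) m :
  (forall i, (i.+1 < m)%N -> 2 * h i.+1 <= h i + h i.+2) ->
  forall i, (i <= m)%N -> h i <= Num.max (h 0) (h m).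
Proof.
elim: m => [|m IH] H i; first by rewrite leqn0 => /eqP ->; rewrite le_max lexx.
have {}IH := IH (fun i im => H i (ltnW im)).
have hm : h m <= Num.max (h 0) (h m.+1).
  case: m IH H => [|m] IH H; first by rewrite le_max lexx.
  have := H m (ltnSn _); have := IH m (leqnSn _).
  rewrite !le_max; have [//|] := leP (h m.+1) (h 0); have [//|] := leP (h m.+1) (h m.+2).
  move=> /= h1 h2 /orP[] h3; lra.
rewrite leq_eqVlt => /predU1P[->|]; first by rewrite le_max lexx orbT.
rewrite ltnS => /IH /le_trans; apply.
by rewrite ge_max hm andbT le_max lexx.
Qed.

(** Cyclicity turns [f (i + j)] into the Frobenius product of [N i] and [N j]. So [f] is
    midpoint-convex along even indices, bounded there by its end values, and at an odd index by the
    mean of its two neighbours. *)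
Lemma mxtrace_mixed_le Y A B m q : Y^T = Y -> A^T = A -> B^T = B ->
  (q <= m.*2)%N ->
  \tr (Y * A ^+ q * Y * B ^+ (m.*2 - q)) <=
  \tr (Y * Y * A ^+ m.*2) + \tr (Y * Y * B ^+ m.*2).
Proof.
move=> sY sA sB qm.
pose f i := \tr (Y * A ^+ i * Y * B ^+ (m.*2 - i)).
pose N i := A ^+ i * Y * B ^+ (m - i).
have fN i j : (i <= m)%N -> (j <= m)%N -> f (i + j)%N = \tr ((N i)^T * N j).
  move=> im jm; rewrite /N !tr_mulr !trmx_sym_exp // sY /f.
  rewrite -!mulrA [RHS]mxtraceC -!mulrA -exprD [A ^+ i * (_ * _)]mulrA -exprD !mulrA.
  by congr (\tr (_ * _ * _ * B ^+ _)); rewrite -addnn; lia.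
have f_ge0 i : (i <= m)%N -> 0 <= f i.*2.
  by move=> im; rewrite -addnn fN // mxtrace_gram_ge0.
have fmid i j : (i <= m)%N -> (j <= m)%N -> 2 * f (i + j)%N <= f i.*2 + f j.*2.
  by move=> im jm; rewrite -!addnn !fN // mxtrace_gram_amgm.
have f0 : f 0 = \tr (Y * Y * B ^+ m.*2) by rewrite /f expr0 mulr1 subn0.
have fm : f m.*2 = \tr (Y * Y * A ^+ m.*2).
  by rewrite /f subnn expr0 mulr1 mxtraceC mulrA.
have fe i : (i <= m)%N -> f i.*2 <= f 0 + f m.*2.
  move=> im; apply: (@le_trans _ _ (Num.max (f 0) (f m.*2))).
    apply: (@midpoint_convex_le_max (fun i => f i.*2)) => // j jm.
    have -> : f j.+1.*2 = f (j + j.+2)%N by congr f; rewrite -addnn; lia.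
    by rewrite fmid //; lia.
  by rewrite ge_max lerDl lerDr f_ge0 //=; exact: (f_ge0 0%N).
rewrite -/(f q) -fm -f0 addrC; have qE := odd_double_half q.
case: (odd q) qE => /= qE; rewrite -qE; last by rewrite add0n fe //; lia.
have -> : (1 + q./2.*2 = q./2 + q./2.+1)%N by rewrite -addnn; lia.
have := fmid q./2 q./2.+1; have := fe q./2; have := fe q./2.+1.
move=> /(_ ltac:(lia)) h1 /(_ ltac:(lia)) h2 /(_ ltac:(lia) ltac:(lia)).
lra.
Qed.

(** By cyclicity the left side is the squared Frobenius norm of [Y * A ^+ m], and [Y] stretches each
    column by at most [L]. *)
Lemma mxtrace_sqr_exp_le Y A m (L : R) : Y^T = Y -> A^T = A ->
  (forall v, norm2 (Y *m v) <= L * norm2 v) ->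
  \tr (Y * Y * A ^+ m.*2) <= L ^+ 2 * \tr (A ^+ m.*2).
Proof.
move=> sY sA YL.
have -> : \tr (Y * Y * A ^+ m.*2) = \tr ((Y * A ^+ m)^T * (Y * A ^+ m)).
  rewrite tr_mulr sY trmx_sym_exp // -!mulrA [RHS]mxtraceC -!mulrA -exprD.
  by rewrite addnn.
have -> : \tr (A ^+ m.*2) = \tr ((A ^+ m)^T * A ^+ m).
  by rewrite trmx_sym_exp // -exprD addnn.
rewrite !mxtrace_gram mulr_sumr ler_sum // => j _.
rewrite -!sqr_norm2 -exprMn lerXn2r ?nnegrE ?norm2_ge0 //.
  by rewrite (le_trans _ (YL _)) // norm2_ge0.
by rewrite -[Y * _]/(Y *m _) !colE -mulmxA YL.
Qed.

Lemma exprD_telescope Y Z k :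
  (Y + Z) ^+ k.+1 =
  Z ^+ k.+1 + \sum_(q < k.+1) (Y + Z) ^+ q * Y * Z ^+ (k - q).
Proof.
elim: k => [|k IH]; first by rewrite big_ord1 !expr1 expr0 mulr1 mul1r addrC.
rewrite exprS IH mulrDr mulrDl -exprS [in RHS]big_ord_recl /= expr0 mul1r.
rewrite subn0 addrA; congr (_ + _); first by rewrite addrC.
rewrite mulr_sumr; apply: eq_bigr => i _.
by rewrite /bump /= add1n subSS exprS !mulrA.
Qed.

(** Telescoping leaves [m.*2.+1] terms in which powers with exponents adding up to [m.*2] separate
    two factors [Y], the shape of [mxtrace_mixed_le]. *)
Lemma mxtrace_exp_step Y Z m (L : R) : Y^T = Y -> Z^T = Z ->
  (forall v, norm2 (Y *m v) <= L * norm2 v) ->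
  \tr (Y * (Y + Z) ^+ m.*2.+1) <= \tr (Y * Z ^+ m.*2.+1) +
    m.*2.+1%:R * L ^+ 2 * (\tr ((Y + Z) ^+ m.*2) + \tr (Z ^+ m.*2)).
Proof.
move=> sY sZ YL; have sX : (Y + Z)^T = Y + Z by rewrite linearD /= sY sZ.
rewrite exprD_telescope mulrDr linearD /= lerD2l mulr_sumr linear_sum /=.
apply: (@le_trans _ _ (\sum_(q < m.*2.+1)
    (L ^+ 2 * (\tr ((Y + Z) ^+ m.*2) + \tr (Z ^+ m.*2))))).
  apply: ler_sum => q _; rewrite !mulrA.
  apply: (le_trans (mxtrace_mixed_le _ _ _ _)) => //; first by rewrite -ltnS.
  by rewrite mulrDr lerD // mxtrace_sqr_exp_le.
by rewrite sumr_const card_ord -mulrA mulr_natl.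
Qed.

(** Cauchy-Schwarz row by row; the trace is the squared Frobenius norm. *)
Lemma norm2_mulmx_gram M v : norm2 (M *m v) ^+ 2 <= \tr (M^T * M) * norm2 v ^+ 2.
Proof.
rewrite mxtraceC !sqr_norm2.
have -> : \tr (M * M^T) = \sum_i dotv (row i M)^T (row i M)^T.
  apply: eq_bigr => i _; rewrite -[_ * _]/(_ *m _) mxE.
  by apply: eq_bigr => j _; rewrite !mxE.
rewrite mulr_suml ler_sum // => i _.
have -> : (M *m v) i ord0 = dotv (row i M)^T v.
  by rewrite mxE; apply: eq_bigr => j _; rewrite !mxE.
rewrite -expr2 -!sqr_norm2 -exprMn -real_normK ?num_real //.
by rewrite lerXn2r ?nnegrE ?mulr_ge0 ?norm2_ge0 // ler_norm_dotv.
Qed.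

(* The sequence [norm2 (X ^+ j v)] is log-convex. *)
Lemma norm2_mulmx_exp X p v : X^T = X -> norm2 v = 1 ->
  norm2 (X *m v) ^+ p <= norm2 (X ^+ p *m v).
Proof.
move=> sX v1; pose a j := norm2 (X ^+ j *m v).
have a0 : a 0 = 1 by rewrite /a expr0 -v1 -[1]/(1%:M) mul1mx.
have a_ge0 j : 0 <= a j by exact: norm2_ge0.
have XS j : X ^+ j.+1 *m v = X *m (X ^+ j *m v).
  by rewrite exprS -[X * _]/(X *m _) mulmxA.
have logc j : a j.+1 ^+ 2 <= a j * a j.+2.
  rewrite sqr_norm2 {1}XS dotv_mulmxl sX -XS; exact: dotv_le.
(* The ratios [a j.+1 / a j] are nondecreasing and start at [a 1]; written without division because
   [a j] may vanish. *)
have aS j : a 1 * a j <= a j.+1.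
  elim: j => [|j IH]; first by rewrite a0 mulr1.
  have [aj0|aj0] := eqVneq (a j) 0.
    have : a j.+1 ^+ 2 <= 0 by rewrite -(mul0r (a j.+2)) -aj0.
    rewrite le_eqVlt ltNge sqr_ge0 orbF sqrf_eq0 => /eqP ->.
    by rewrite mulr0.
  have ajp : 0 < a j by rewrite lt_neqAle eq_sym aj0 a_ge0.
  rewrite -(ler_pM2l ajp); apply: (le_trans _ (logc j)).
  by rewrite mulrCA mulrA expr2 ler_wpM2r.
have -> : norm2 (X *m v) = a 1 by rewrite /a expr1.
rewrite -/(a p); elim: p => [|p IH]; first by rewrite expr0 a0.
by rewrite exprS (le_trans _ (aS p)) // ler_wpM2l.
Qed.

(** For a unit vector [w], [norm2 (X *m w) ^+ p.*2] is at most [norm2 (X ^+ p *m w) ^+ 2], hence at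
    most the trace; this takes the place of diagonalizing [X]. *)
Lemma opnorm_le_of_mxtrace_exp X p (t : R) : X^T = X -> (0 < p)%N -> 0 <= t ->
  \tr (X ^+ p.*2) <= t ^+ p.*2 -> opnorm X <= t.
Proof.
move=> sX p0 t0 Xt; apply: opnorm_le => // v.
have [->|v0] := eqVneq v 0; first by rewrite mulmx0 !norm2_0 mulr0.
have nv : 0 < norm2 v by rewrite lt_neqAle norm2_ge0 eq_sym norm2_eq0 v0.
rewrite -ler_pdivrMr // mulrC; have ni : `|(norm2 v)^-1| = (norm2 v)^-1.
  by rewrite ger0_norm // invr_ge0 ltW.
rewrite -ni -norm2Z scalemxAr; set w := _ *: v.
have w1 : norm2 w = 1 by rewrite norm2Z ni mulVf // gt_eqF.
rewrite -(ler_pXn2r (n := p.*2)) ?nnegrE ?norm2_ge0 ?double_gt0 //.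
apply: le_trans Xt; rewrite -muln2 !exprM.
apply: (@le_trans _ _ (norm2 (X ^+ p *m w) ^+ 2)).
  by rewrite lerXn2r ?nnegrE ?exprn_ge0 ?norm2_ge0 ?norm2_mulmx_exp.
apply: (le_trans (norm2_mulmx_gram _ _)).
by rewrite w1 expr1n mulr1 trmx_sym_exp // expr2.
Qed.

Lemma mxtrace_exp_even_ge0 X p : X^T = X -> 0 <= \tr (X ^+ p.*2).
Proof.
by move=> sX; rewrite -addnn exprD -{1}(trmx_sym_exp p sX) mxtrace_gram_ge0.
Qed.

End trace_powers.

(** * Moments of sums of centered random matrices *)

Lemma Rintegral_sum {R : realType} {d} {S : measurableType d}
    (mu : {measure set S -> \bar R}) (D : set S) I (s : seq I) (Q : pred I)
    (F : I -> S -> R) : measurable D ->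
  (forall i, mu.-integrable D (EFin \o F i)) ->
  \int[mu]_(w in D) (\sum_(i <- s | Q i) F i w) =
  \sum_(i <- s | Q i) \int[mu]_(w in D) F i w.
Proof.
move=> mD iF; elim: s => [|i s IH].
  under eq_Rintegral do rewrite big_nil.
  by rewrite big_nil Rintegral_cst // mul0r.
under eq_Rintegral do rewrite big_cons.
rewrite big_cons; case: (Q i) => //.
rewrite RintegralD ?IH //.
rewrite (_ : _ \o _ = fun w => (\sum_(i <- s | Q i) (F i w)%:E)%E).
  by apply: integrable_sum => // j _; exact: iF.
by apply/funext => w /=; rewrite sumEFin.
Qed.

(** * Bounded measurable functions and matrices *)

Section bounded_measurable.
Context {R : realType} {d} {S : measurableType d}.

(** A class closed under sums and products and integrable for every probability, so that
    integrability of traces of matrix polynomials follows from their shape. *)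
Definition bounded_measurable (f : S -> R) :=
  measurable_fun [set: S] f /\ exists M : R, forall w, `|f w| <= M.

Lemma bounded_measurable_cst (a : R) : bounded_measurable (fun=> a).
Proof. by split; [exact: measurable_cst|exists `|a|]. Qed.

Lemma bounded_measurableD f g : bounded_measurable f -> bounded_measurable g ->
  bounded_measurable (fun w => f w + g w).
Proof.
move=> [mf [M fM]] [mg [N gN]]; split; first exact: measurable_funD.
by exists (M + N) => w; rewrite (le_trans (ler_normD _ _)) // lerD.
Qed.

Lemma bounded_measurableM f g : bounded_measurable f -> bounded_measurable g ->
  bounded_measurable (fun w => f w * g w).
Proof.
move=> [mf [M fM]] [mg [N gN]]; split; first exact: measurable_funM.
by exists (M * N) => w; rewrite normrM ler_pM.
Qed.

Lemma bounded_measurable_sum I (s : seq I) (Q : pred I) (F : I -> S -> R) :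
  (forall i, bounded_measurable (F i)) ->
  bounded_measurable (fun w => \sum_(i <- s | Q i) F i w).
Proof.
move=> bF; elim: s => [|i s IH].
  under eq_fun do rewrite big_nil.
  exact: bounded_measurable_cst.
under eq_fun do rewrite big_cons.
by case: (Q i) => //; exact: bounded_measurableD.
Qed.

Lemma bounded_measurable_indic (A : set S) : measurable A ->
  bounded_measurable (\1_A : S -> R).
Proof.
move=> mA; split; first exact: measurable_indic.
by exists 1 => w; rewrite indicE; case: (_ \in _); rewrite ?normr1 ?normr0.
Qed.

Lemma bounded_measurable_integrable (P : probability S R) f :
  bounded_measurable f -> P.-integrable [set: S] (EFin \o f).
Proof.
move=> [mf [M fM]]; apply: measurable_bounded_integrable => //.
  exact: le_lt_trans (probability_le1 P measurableT) (ltry _).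
by exists M; split; [exact: num_real|move=> x Mx w _; exact: le_trans (fM w) (ltW Mx)].
Qed.

Lemma Rintegral_probability_cst (P : probability S R) (a : R) : \int[P]_w a = a.
Proof.
rewrite Rintegral_cst // [X in fine X](_ : _ = 1%E) ?mulr1 //.
exact: probability_setT.
Qed.

Lemma Rintegral_sum_bounded (P : probability S R) I (s : seq I) (Q : pred I)
    (F : I -> S -> R) : (forall i, bounded_measurable (F i)) ->
  \int[P]_w (\sum_(i <- s | Q i) F i w) = \sum_(i <- s | Q i) \int[P]_w F i w.
Proof.
by move=> bF; apply: Rintegral_sum => // i; exact: bounded_measurable_integrable.
Qed.

Definition bounded_measurable_mx m n (A : S -> 'M[R]_(m, n)) :=
  forall i j, bounded_measurable (fun w => A w i j).

Lemma bounded_measurable_mxM m n p (A : S -> 'M[R]_(m, n)) (B : S -> 'M[R]_(n, p)) :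
  bounded_measurable_mx A -> bounded_measurable_mx B ->
  bounded_measurable_mx (fun w => A w *m B w).
Proof.
move=> bA bB i j; under eq_fun do rewrite mxE.
by apply: bounded_measurable_sum => k; exact: bounded_measurableM.
Qed.

Lemma bounded_measurable_mxX n (A : S -> 'M[R]_n) k :
  bounded_measurable_mx A -> bounded_measurable_mx (fun w => A w ^+ k).
Proof.
move=> bA; elim: k => [|k IH] i j.
  under eq_fun do rewrite expr0.
  exact: bounded_measurable_cst.
under eq_fun do rewrite exprS.
exact: bounded_measurable_mxM.
Qed.

Lemma bounded_measurable_mx_sum m n I (s : seq I) (Q : pred I)
    (F : I -> S -> 'M[R]_(m, n)) : (forall i, bounded_measurable_mx (F i)) ->
  bounded_measurable_mx (fun w => \sum_(i <- s | Q i) F i w).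
Proof.
move=> bF i j; under eq_fun do rewrite summxE.
by apply: bounded_measurable_sum => k; exact: bF.
Qed.

Lemma bounded_measurable_mxtrace n (A : S -> 'M[R]_n) :
  bounded_measurable_mx A -> bounded_measurable (fun w => \tr (A w)).
Proof. by move=> bA; apply: bounded_measurable_sum => k; exact: bA. Qed.

End bounded_measurable.

(** * Even trace moments, by induction on the exponent *)

Section matrix_moments.
Context {R : realType} {d} {S : measurableType d} (P : probability S R).
Context {n N : nat} (Y : 'I_N -> S -> 'M[R]_n) (L : R).
Hypothesis bY : forall i, bounded_measurable_mx (Y i).
Hypothesis sY : forall i w, (Y i w)^T = Y i w.
Hypothesis YL : forall i w v, norm2 (Y i w *m v) <= L * norm2 v.
(** The form in which independence and centering enter. It ranges over all subsets [A] because the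
    induction removes summands. *)
Hypothesis cY : forall i (A : {set 'I_N}) q, i \notin A ->
  \int[P]_w \tr (Y i w * (\sum_(j in A) Y j w) ^+ q) = 0.

Let X (A : {set 'I_N}) w := \sum_(j in A) Y j w.

Let sX A w : (X A w)^T = X A w.
Proof. by rewrite /X linear_sum /=; apply: eq_bigr => i _. Qed.

Let bX A : bounded_measurable_mx (X A).
Proof. exact: bounded_measurable_mx_sum. Qed.

Let btrX A k : bounded_measurable (fun w => \tr (X A w ^+ k)).
Proof. exact/bounded_measurable_mxtrace/bounded_measurable_mxX. Qed.

Let btrYX i A k : bounded_measurable (fun w => \tr (Y i w * X A w ^+ k)).
Proof.
apply: bounded_measurable_mxtrace; apply: bounded_measurable_mxM => //.
exact: bounded_measurable_mxX.
Qed.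

(* Peeling off one factor [Y_i] and removing [Y_i] from the remaining power:
   the term with independent factors vanishes. *)
Lemma mxtrace_moment_step A p (B : R) :
  (forall A, \int[P]_w \tr (X A w ^+ p.*2) <= B) ->
  \int[P]_w \tr (X A w ^+ p.+1.*2) <= (4 * p.+1 * N)%:R * L ^+ 2 * B.
Proof.
move=> IH.
have B0 : 0 <= B.
  by apply: le_trans (IH A); apply: Rintegral_ge0 => w _; exact: mxtrace_exp_even_ge0.
have -> : \int[P]_w \tr (X A w ^+ p.+1.*2) =
    \sum_(i in A) \int[P]_w \tr (Y i w * X A w ^+ p.*2.+1).
  rewrite -Rintegral_sum_bounded; last by move=> i; exact: btrYX.
  by apply: eq_Rintegral => w _; rewrite doubleS exprS mulr_suml linear_sum.
apply: (@le_trans _ _ (\sum_(i in A) p.*2.+1%:R * L ^+ 2 * (B + B))).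
  apply: ler_sum => i iA; pose Z := X (A :\ i).
  have XE w : X A w = Y i w + Z w by rewrite /X (big_setD1 i iA).
  pose g w := p.*2.+1%:R * L ^+ 2 * (\tr (X A w ^+ p.*2) + \tr (Z w ^+ p.*2)).
  have bg : bounded_measurable g.
    apply: bounded_measurableM; first exact: bounded_measurable_cst.
    by apply: bounded_measurableD; exact: btrX.
  apply: (@le_trans _ _ (\int[P]_w (\tr (Y i w * Z w ^+ p.*2.+1) + g w))).
    apply: le_Rintegral => //.
    - exact/bounded_measurable_integrable/btrYX.
    - apply: bounded_measurable_integrable.
      by apply: bounded_measurableD => //; exact: btrYX.
    - by move=> w _; rewrite /g XE mxtrace_exp_step // sX.
  rewrite RintegralD //; try exact: bounded_measurable_integrable; last first.
    exact/bounded_measurable_integrable/btrYX.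
  (* [i] is not in [A :\ i], so the first trace has mean zero; the assumption on exponent [p.*2]
     bounds the two others. *)
  rewrite cY ?add0r ?setD11 // RintegralZl //; last first.
    apply: bounded_measurable_integrable.
    by apply: bounded_measurableD; exact: btrX.
  rewrite RintegralD //; try exact/bounded_measurable_integrable/btrX.
  by apply: ler_wpM2l; [rewrite mulr_ge0 ?sqr_ge0|exact: lerD (IH _) (IH _)].
have cA : (#|A| <= N)%N by rewrite -[N in leqRHS]card_ord max_card.
rewrite sumr_const -[leLHS]mulr_natl.
have -> : #|A|%:R * (p.*2.+1%:R * L ^+ 2 * (B + B)) =
    (#|A| * p.*2.+1 * 2)%:R * (L ^+ 2 * B) :> R by rewrite !natrM; ring.
rewrite -mulrA ler_wpM2r ?(mulr_ge0 (sqr_ge0 _)) // ler_nat.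
have : (#|A| * p.*2.+1 * 2 <= N * p.*2.+1 * 2)%N by rewrite !leq_mul2r cA orbT.
by move=> /leq_trans; apply; nia.
Qed.

Lemma mxtrace_moment_le A p :
  \int[P]_w \tr (X A w ^+ p.*2) <= n%:R * ((4 * p * N)%:R * L ^+ 2) ^+ p.
Proof.
(* Freezing the factor at [4 * p * N] for all [k <= p] gives the induction a constant ratio. *)
suff H k : (k <= p)%N -> forall A,
    \int[P]_w \tr (X A w ^+ k.*2) <= n%:R * ((4 * p * N)%:R * L ^+ 2) ^+ k.
  exact: H.
elim: k => [_ A'|k IH kp A'].
  under eq_Rintegral do rewrite expr0.
  by rewrite mxtrace1 Rintegral_probability_cst expr0 mulr1.
apply: (le_trans (mxtrace_moment_step A' (IH (ltnW kp)))).
have c0 : 0 <= (4 * p * N)%:R * L ^+ 2 by rewrite mulr_ge0 ?sqr_ge0.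
rewrite [_ ^+ k.+1]exprS [leRHS]mulrCA ler_wpM2r ?(mulr_ge0 _ (exprn_ge0 _ c0)) //.
by rewrite ler_wpM2r ?sqr_ge0 // ler_nat leq_mul2r leq_mul2l kp !orbT.
Qed.

End matrix_moments.

Lemma markov_bounded {R : realType} {d} {S : measurableType d}
    (P : probability S R) (f : S -> R) (a b : R) :
  bounded_measurable f -> (forall w, 0 <= f w) -> 0 < a ->
  \int[P]_w f w <= b * a -> ((1 - b)%:E <= P [set w | (f w <= a)%R])%E.
Proof.
move=> bf f0 a0 Efb; have mf := bf.1.
have mA : measurable [set w | f w <= a].
  rewrite (_ : [set w | _] = f @^-1` `]-oo, a]).
    by rewrite -[X in measurable X]setTI; exact: mf.
  by apply/seteqP; split => w /=; rewrite in_itv.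
rewrite -[X in P X]setCK probability_setC; last exact: measurableC.
set B := ~` _; have mB : measurable B by exact: measurableC.
have PB : P B = (\int[P]_w \1_B w)%:E.
  rewrite /Rintegral fineK ?integral_indic ?setIT //.
  exact: fin_num_measure.
rewrite PB -EFinB lee_fin lerB // -(ler_pM2r a0); apply: le_trans Efb.
rewrite -RintegralZr //; last exact/bounded_measurable_integrable/bounded_measurable_indic.
apply: le_Rintegral => //; try exact: bounded_measurable_integrable.
  apply: bounded_measurable_integrable; apply: bounded_measurableM.
    exact: bounded_measurable_indic.
  exact: bounded_measurable_cst.
move=> w _; rewrite indicE; have [wB|] := boolP (w \in B); last by rewrite mul0r.
by rewrite mul1r ltW // ltNge; apply/negP => fa; move: wB; rewrite inE; apply.
Qed.

(** * Joint laws of independent variables *)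

Section joint_law.
Context {R : realType} {dS dZ dE} {S : measurableType dS}
  {Z : measurableType dZ} {E : measurableType dE} (P : probability S R)
  (mu : {sigma_finite_measure set E -> \bar R}) (phi : {mfun S >-> Z})
  (X : {mfun S >-> E}).
Hypothesis mu1 : mu [set: E] = 1%E.

(** As functions of [A] both sides are finite measures, the law of [phi] restricted to the event
    [X \in B] and the law of [phi] scaled by [mu B]; agreement on a pi-system suffices. *)
Lemma independent_of_generator (G : set (set Z)) :
  measurable = <<s G >> -> setI_closed G -> G [set: Z] ->
  (forall A B, G A -> measurable B ->
    P (phi @^-1` A `&` X @^-1` B) = (P (phi @^-1` A) * mu B)%E) ->
  forall A B, measurable A -> measurable B ->
    P (phi @^-1` A `&` X @^-1` B) = (P (phi @^-1` A) * mu B)%E.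
Proof.
move=> mG GI GT GP A B mA mB.
have mXB : measurable (X @^-1` B).
  by rewrite -[X in measurable X]setTI; exact: measurable_funPT.
have muB1 : (mu B <= 1)%E by rewrite -mu1 le_measure ?inE.
have muBE : mu B = (fine (mu B))%:E.
  by rewrite fineK // ge0_fin_numE // (le_lt_trans muB1) // ltry.
pose k : {nonneg R} := NngNum (fine_ge0 (measure_ge0 mu B)).
pose m0 := (pushforward (mrestr P mXB) phi : {measure set Z -> \bar R}).
pose m1 := m0 (measurable_funPT phi).
pose m2 : {measure set Z -> \bar R} := mscale k (distribution P phi).
have m2E C : m2 C = (P (phi @^-1` C) * mu B)%E.
  by rewrite /m2 /= /mscale /= muBE muleC.
rewrite -m2E. change (m1 A = m2 A).
apply: (measure_unique G (fun=> [set: Z])) => //.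
- by rewrite bigcup_const.
- by move=> C GC; rewrite m2E -GP.
- move=> _; apply: (@le_lt_trans _ _ 1%E); last exact: ltry.
  by apply: probability_le1; rewrite preimage_setT; apply: measurableI.
Qed.

Hypothesis indep : forall A B, measurable A -> measurable B ->
  P (phi @^-1` A `&` X @^-1` B) = (P (phi @^-1` A) * mu B)%E.

Let pairX := (fun w => (phi w, X w)) : S -> (Z * E)%type.

Let mpairX : measurable_fun [set: S] pairX.
Proof. by apply/measurable_fun_pair; exact: measurable_funPT. Qed.

Lemma joint_law D : measurable D ->
  P (pairX @^-1` D) = (distribution P phi \x mu)%E D.
Proof.
move=> mD.
pose q : {mfun S >-> (Z * E)%type} := mfun_Sub (mem_set mpairX).
rewrite (@product_measure_unique _ _ _ _ _ (distribution P phi) mu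
  (distribution P q)) // => A B mA mB; rewrite -indep.
Qed.

(** After transport to the product law, Fubini integrates over [mu] first, where the mean is
    zero. *)
Lemma Rintegral_joint_eq0 (f : Z * E -> R) : bounded_measurable f ->
  (forall z, \int[mu]_x f (z, x) = 0) -> \int[P]_w f (phi w, X w) = 0.
Proof.
move=> bf f0; have [mf [M fM]] := bf.
pose q : {mfun S >-> (Z * E)%type} := mfun_Sub (mem_set mpairX).
have bfq : bounded_measurable (fun w => f (phi w, X w)).
  split; last by exists M.
  exact: (measurableT_comp mf mpairX).
have mEf : measurable_fun [set: Z * E] (EFin \o f) by exact/measurable_EFinP.
have Ifq : P.-integrable [set: S] ((EFin \o f) \o q).
  exact: bounded_measurable_integrable bfq.
have PT : ((distribution P phi \x mu)%E [set: Z * E] <= 1)%E.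
  by rewrite -joint_law // preimage_setT; apply: probability_le1.
have If : (distribution P phi \x mu)%E.-integrable [set: Z * E] (EFin \o f).
  apply: measurable_bounded_integrable => //.
    exact: le_lt_trans PT (ltry _).
  by exists M; split; [exact: num_real|move=> x Mx w _; exact: le_trans (fM _) (ltW Mx)].
rewrite /Rintegral -[LHS]/(fine (\int[P]_w ((EFin \o f) \o q) w)).
rewrite -integral_distribution //.
rewrite (eq_measure_integral (distribution P phi \x mu)%E); last first.
  by move=> A mA _; exact: (joint_law mA).
rewrite -integral12_prod_meas1 // integral0_eq // => z _.
have := f0 z; rewrite /fubini_F /Rintegral.
have mfz : measurable_fun [set: E] (fun x => f (z, x)).
  exact: (measurableT_comp mf (pair1_measurable z)).
move=> h; rewrite -[LHS]fineK ?h //.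
apply: integrable_fin_num => //; apply: measurable_bounded_integrable => //.
  by rewrite [X in (X < _)%E]mu1 ltry.
by exists M; split; [exact: num_real|move=> x Mx w _; exact: le_trans (fM _) (ltW Mx)].
Qed.

End joint_law.

(** * Conditionally independent samples *)

Section iid_centered.
Context {R : realType} {d N : nat} {dS dT} {S : measurableType dS}
  {T : measurableType dT} (P : probability S R)
  (mu : {sigma_finite_measure set 'cV[R]_d -> \bar R})
  (theta : S -> T) (X : 'I_N -> S -> 'cV[R]_d).
Hypothesis mu1 : mu [set: 'cV[R]_d] = 1%E.
Hypothesis iid : iid_given P mu theta X.

Let mtheta : measurable_fun [set: S] theta. Proof. by case: iid. Qed.
Let mX n : measurable_fun [set: S] (X n). Proof. by case: iid. Qed.

Lemma iid_given_joint_law n D : measurable D ->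
  P ((fun w => (theta w, X n w)) @^-1` D) =
  (distribution P (mfun_Sub (mem_set mtheta)) \x mu)%E D.
Proof.
move=> mD.
apply: (@joint_law _ _ _ _ _ _ _ P mu (mfun_Sub (mem_set mtheta))
  (mfun_Sub (mem_set (mX n)))) => // A B mA mB /=.
have [_ _ H] := iid.
(* Whole spaces at the indices other than [n] leave a condition on [theta] and [X n] alone; their
   factors are [1]. *)
have := H A (fun j => if j == n then B else [set: _]) mA.
rewrite (bigD1 n) //= eqxx big1 => [|j /negbTE ->]; last exact: mu1.
rewrite mule1 => <-; last by move=> j; case: ifP.
congr (P _); apply/seteqP; split => w /= [Aw].
  by move=> Bw; split => // j; case: eqP => // ->.
by move=> /(_ n); rewrite eqxx.
Qed.

Section leave_one_out.
Variable i : 'I_N.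

(** Cylinders in [theta] and the samples other than the [i]-th, a pi-system. *)
Let gen : set (set S) := [set C | exists (B : set T) (A : 'I_N -> set 'cV[R]_d),
  [/\ measurable B, forall j, measurable (A j) &
      C = [set w | B (theta w) /\ forall j, j != i -> A j (X j w)]]].

(** The points of [S] with the coarser sigma-algebra of these cylinders: the identity into [Z] acts
    as a random variable independent of [X i]. *)
Let Z := g_sigma_algebraType gen.

Let mC C : gen C -> measurable (C : set S).
Proof.
move=> [B [A [mB mA ->]]].
rewrite (_ : [set w | _] = theta @^-1` B `&`
    \bigcap_(j in [set j | j != i]) (X j @^-1` A j)).
  apply: measurableI; first by rewrite -[X in measurable X]setTI; exact: mtheta.
  apply: fin_bigcap_measurable => [|j _]; first exact: finite_finset.
  by rewrite -[X in measurable X]setTI; exact: mX.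
by apply/seteqP; split => w /= [Bw Aw]; split => // j; exact: Aw.
Qed.

Let mid : measurable_fun [set: S] (id : S -> Z).
Proof.
apply: (@measurability _ _ S Z _ _ gen) => // _ [C gC <-].
by rewrite setTI; exact: mC.
Qed.

Let mthetaZ : measurable_fun [set: Z] (theta : Z -> T).
Proof.
move=> _ B mB; rewrite setTI; apply: sub_sigma_algebra.
exists B, (fun=> [set: _]); split => //.
by apply/seteqP; split => w //= [].
Qed.

Let mXZ j : j != i -> measurable_fun [set: Z] (X j : Z -> 'cV[R]_d).
Proof.
move=> ji _ B mB; rewrite setTI; apply: sub_sigma_algebra.
exists [set: T], (fun k => if k == j then B else [set: _]); split => //.
  by move=> k; case: ifP.
apply/seteqP; split => w /=.
  by move=> Bw; split => // k _; case: eqP => // ->.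
by move=> [_ /(_ j ji)]; rewrite eqxx.
Qed.

(** As [i] is not in [A], the power is measurable on [Z]. The trace is linear in the other factor,
    which has mean zero once the cylinder variable is fixed. This provides the hypothesis [cY] of
    the moment bound. *)
Lemma iid_given_centered (n : nat) (y : T * 'cV[R]_d -> 'M[R]_n)
    (A : {set 'I_N}) q :
  bounded_measurable_mx y -> (forall t a b, \int[mu]_x y (t, x) a b = 0) ->
  i \notin A ->
  \int[P]_w \tr (y (theta w, X i w) *
    (\sum_(j in A) y (theta w, X j w)) ^+ q) = 0.
Proof.
move=> by_ y0 iA.
pose K (z : Z) := (\sum_(j in A) y (theta z, X j z)) ^+ q.
have bK : bounded_measurable_mx K.
  apply: bounded_measurable_mxX => a b; under eq_fun do rewrite summxE.
  (* The summand at [j = i] does not occur; replacing it by [0] makes every summand measurable on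
     [Z]. *)
  rewrite (_ : (fun _ => _) = fun z : Z =>
    \sum_(j | j \in A) (if j == i then 0 else y (theta z, X j z) a b)); last first.
    apply/funext => z; apply: eq_bigr => j jA.
    by case: eqP => // ji; rewrite -ji jA in iA.
  apply: bounded_measurable_sum => j; case: eqP => [_|/eqP ji].
    exact: bounded_measurable_cst.
  have [my [M yM]] := by_ a b; split; last by exists M.
  apply: (measurableT_comp my); apply/measurable_fun_pair => //=.
  exact: mXZ.
pose f (p : Z * 'cV[R]_d) := \tr (y (theta p.1, p.2) * K p.1).
have bf : bounded_measurable f.
  apply: bounded_measurable_mxtrace; apply: bounded_measurable_mxM => a b.
    have [my [M yM]] := by_ a b; split; last by exists M.
    apply: (measurableT_comp my); apply/measurable_fun_pair => //=.
    exact: measurableT_comp.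
  have [mK [M KM]] := bK a b; split; last by exists M.
  exact: (measurableT_comp mK).
have muT : (mu [set: 'cV[R]_d] < +oo)%E by rewrite [X in (X < _)%E]mu1 ltry.
apply: (@Rintegral_joint_eq0 _ _ _ _ S Z _ P mu (mfun_Sub (mem_set mid))
  (mfun_Sub (mem_set (mX i))) mu1 _ f bf) => [|z].
  apply: (@independent_of_generator _ _ _ _ S Z _ P mu (mfun_Sub (mem_set mid))
    (mfun_Sub (mem_set (mX i))) mu1 gen) => //=.
  - move=> _ _ [B1 [A1 [mB1 mA1 ->]]] [B2 [A2 [mB2 mA2 ->]]].
    exists (B1 `&` B2), (fun j => A1 j `&` A2 j); split.
    + exact: measurableI.
    + by move=> j; exact: measurableI.
    + apply/seteqP; split => w /=.
        by move=> [[? H1] [? H2]]; split => // j ji; split; [exact: H1|exact: H2].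
      by move=> [[? ?] H]; split; split => // j /H[].
  - exists [set: T], (fun=> [set: _]); split => //.
    by apply/seteqP; split.
  - move=> _ B [B1 [A1 [mB1 mA1 ->]]] mB.
    have [_ _ H] := iid.
    (* The product formula is used twice, with [B] and with the whole space at index [i]; the two
       differ by the factor [mu B]. *)
    have := H B1 (fun j => if j == i then B else A1 j) mB1.
    rewrite (bigD1 i) //= eqxx => HB.
    have := H B1 (fun j => if j == i then [set: _] else A1 j) mB1.
    rewrite (bigD1 i) //= eqxx mu1 mul1e => HT.
    rewrite (_ : _ `&` _ = [set w | B1 (theta w) /\
        forall j, (if j == i then B else A1 j) (X j w)]); last first.
      apply/seteqP; split => w /=.
        move=> [[? H1] ?]; split => // j.
        by case: eqP => [->//|/eqP]; exact: H1.
      move=> [? H1]; split; last by have := H1 i; rewrite eqxx.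
      by split => // j ji; have := H1 j; rewrite (negbTE ji).
    rewrite HB; last by move=> j; case: ifP.
    rewrite [X in _ = (P X * _)%E](_ : _ = [set w | B1 (theta w) /\
        forall j, (if j == i then [set: _] else A1 j) (X j w)]); last first.
      apply/seteqP; split => w /=.
        move=> [? H1]; split => // j.
        by case: eqP => [//|/eqP]; exact: H1.
      by move=> [? H1]; split => // j ji; have := H1 j; rewrite (negbTE ji).
    rewrite HT; last by move=> j; case: ifP.
    rewrite -muleA; congr (_ * _)%E; rewrite muleC; congr (_ * _)%E.
    by apply: eq_bigr => j /negbTE ->.
rewrite /f /=.
have Iy a b : mu.-integrable [set: 'cV[R]_d] (EFin \o (fun x => y (theta z, x) a b)).
  have [my [M yM]] := by_ a b.
  apply: measurable_bounded_integrable => //.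
    exact: (measurableT_comp my (pair1_measurable _)).
  by exists M; split; [exact: num_real|move=> x Mx w _; exact: le_trans (yM _) (ltW Mx)].
have -> : (fun x : 'cV[R]_d => \tr (y (theta z, x) * K z)) =
    fun x => \sum_a \sum_b y (theta z, x) a b * K z b a.
  by apply/funext => x; apply: eq_bigr => a _; rewrite -[_ * K z]/(_ *m _) mxE.
have IyK a b : mu.-integrable [set: 'cV[R]_d]
    (EFin \o (fun x => y (theta z, x) a b * K z b a)).
  rewrite (_ : _ \o _ = fun x => ((K z b a)%:E * (y (theta z, x) a b)%:E)%E).
    exact: (integrableZl measurableT (K z b a) (Iy a b)).
  by apply/funext => x; rewrite /= mulrC EFinM.
rewrite Rintegral_sum // => [|a]; last first.
  rewrite (_ : _ \o _ = fun x => (\sum_b (y (theta z, x) a b * K z b a)%:E)%E).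
    by apply: integrable_sum => // b _; exact: IyK.
  by apply/funext => x /=; rewrite sumEFin.
rewrite big1 // => a _; rewrite Rintegral_sum // big1 // => b _.
by rewrite RintegralZr // y0 mul0r.
Qed.

End leave_one_out.
End iid_centered.

(** * Perturbation of gradient covariances *)

Section measurable_opnorm.
Context {R : realType}.

Let rat_cV n (q : {ffun 'I_n -> rat}) : 'cV[R]_n := \col_i ratr (q i).

Let rat_cV_dense n (v : 'cV[R]_n) (e : R) : 0 < e ->
  exists q : {ffun 'I_n -> rat}, norm2 (v - rat_cV q) <= e.
Proof.
move=> e0; pose e' := e / n.+1%:R.
have e'0 : 0 < e' by rewrite divr_gt0.
have qP i : exists q : rat, ratr q \in `](v i ord0 - e'), (v i ord0 + e')[.
  by apply: rat_in_itvoo; rewrite ltrBlDr -addrA ltrDl addr_gt0.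
exists [ffun i => sval (cid (qP i))]; set q := finfun _.
have -> : v - rat_cV q = \sum_i (v i ord0 - ratr (q i)) *: delta_mx i ord0.
  by rewrite [LHS]matrix_sum_delta; apply: eq_bigr => i _; rewrite big_ord1 !mxE.
apply: (le_trans (norm2_sum_le _ _)).
apply: (@le_trans _ _ (\sum_(i < n) e')).
  apply: ler_sum => i _; rewrite norm2Z norm2_delta mulr1 ffunE.
  have := svalP (cid (qP i)); rewrite in_itv /= => /andP[h1 h2].
  by rewrite ler_distlC ltW //= ltW // -ltrBlDr.
rewrite sumr_const card_ord -[leLHS]mulr_natr /e' mulrAC ler_pdivrMr //.
by rewrite ler_pM2l // ler_nat.
Qed.

(** Density of rational vectors reduces the bound to countably many conditions, which makes sublevel
    sets of [opnorm] measurable. *)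
Lemma opnorm_le_rat m n (A : 'M[R]_(m, n)) (b : R) : 0 <= b ->
  (forall q, norm2 (A *m rat_cV q) <= b * norm2 (rat_cV q)) -> opnorm A <= b.
Proof.
move=> b0 H; apply: opnorm_le => // v.
have [M M0 AM] := norm2_mulmx_bounded A.
(* Replacing [v] by a rational vector costs [b + M] times their distance; the extra [1] keeps the
   denominator positive. *)
apply/ler_addgt0Pr => e e0; pose e' := e / (b + M + 1).
have bM : 0 < b + M + 1 by rewrite ltr_wpDl ?addr_ge0.
have [q vq] := rat_cV_dense v (divr_gt0 e0 bM).
have -> : A *m v = A *m (rat_cV q) + A *m (v - rat_cV q).
  by rewrite -mulmxDr addrC subrK.
apply: (le_trans (ler_norm2D _ _)).
have h1 : norm2 (rat_cV q) <= norm2 v + norm2 (v - rat_cV q).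
  rewrite -[X in norm2 X <= _](subKr v) (le_trans (ler_norm2D _ _)) // lerD2l.
  by rewrite -scaleN1r norm2Z normrN1 mul1r.
have h2 := AM (v - rat_cV q); have h3 := H q.
have h4 : b * norm2 (rat_cV q) <= b * (norm2 v + norm2 (v - rat_cV q)).
  by rewrite ler_wpM2l.
have : (b + M) * norm2 (v - rat_cV q) <= e; last by move: h1 h2 h3 h4; lra.
apply: (@le_trans _ _ ((b + M) * (e / (b + M + 1)))).
  by rewrite ler_wpM2l ?addr_ge0.
by rewrite mulrA ler_pdivrMr // [leRHS]mulrC ler_wpM2r ?(ltW e0) // lerDl.
Qed.

Lemma measurable_opnorm_le d (S : measurableType d) m n
    (A : S -> 'M[R]_(m, n)) (b : R) : 0 <= b ->
  (forall i j, measurable_fun [set: S] (fun w => A w i j)) ->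
  measurable [set w | opnorm (A w) <= b].
Proof.
move=> b0 mA.
pose F q := [set w | norm2 (A w *m rat_cV q) <= b * norm2 (rat_cV q)].
have mF q : measurable (F q).
  have -> : F q = [set: S] `&` [set w | dotv (A w *m rat_cV q) (A w *m rat_cV q)
      <= (b * norm2 (rat_cV q)) ^+ 2].
    rewrite setTI; apply/seteqP; split => w /=; rewrite /F /=;
      by rewrite -sqr_norm2 ler_pXn2r // nnegrE ?mulr_ge0 ?norm2_ge0.
  apply: measurable_fun_le => //.
  apply: measurable_sum => i.
  have mAi : measurable_fun [set: S] (fun w => (A w *m rat_cV q) i ord0).
    under eq_fun do rewrite mxE.
    apply: measurable_sum => j; exact: measurable_funM.
  exact: measurable_funM.
have -> : [set w | opnorm (A w) <= b] = ~` \bigcup_(q in [set: {ffun 'I_n -> rat}]) ~` F q.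
  apply/seteqP; split => w /=.
    move=> Ab [q _]; apply; rewrite /F /= (le_trans (norm2_mulmx_le _ _)) //.
    by rewrite ler_wpM2r ?norm2_ge0.
  move=> H; apply: opnorm_le_rat => // q; apply: contrapT => nF.
  by apply: H; exists q.
apply: measurableC; apply: countable_bigcupT_measurable => [|q].
  exact: countableP.
exact: measurableC.
Qed.

End measurable_opnorm.

(** Tonelli applies to the positive and negative parts separately, and [fine] is measurable, so an
    infinite difference does no harm. *)
Lemma measurable_fun_Rintegral {R : realType} {dT dE} {T : measurableType dT}
    {E : measurableType dE} (mu : {sigma_finite_measure set E -> \bar R})
    (f : T * E -> R) : measurable_fun [set: T * E] f ->
  measurable_fun [set: T] (fun t => \int[mu]_x f (t, x)).
Proof.
move=> mf; have mEf : measurable_fun [set: T * E] (EFin \o f).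
  exact/measurable_EFinP.
rewrite /Rintegral; apply: measurableT_comp; first exact: fine_measurable.
rewrite (_ : (fun _ => _) = fun t =>
    (fubini_F mu (EFin \o f)^\+ t - fubini_F mu (EFin \o f)^\- t)%E); last first.
  apply/funext => t; rewrite integralE /fubini_F.
  by congr (_ - _)%E; apply: eq_integral => x _; rewrite ?funeposE ?funenegE.
apply: emeasurable_funB; apply: measurable_fun_fubini_tonelli_F => //.
- exact: measurable_funepos.
- exact: measurable_funeneg.
Qed.

Section integrable_real.
Context {R : realType} {d} {S : measurableType d} (mu : {measure set S -> \bar R})
  (D : set S).
Hypothesis mD : measurable D.
Implicit Types f g : S -> R.

Lemma integrable_addr f g : mu.-integrable D (EFin \o f) ->
  mu.-integrable D (EFin \o g) -> mu.-integrable D (EFin \o (fun x => f x + g x)).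
Proof. by move=> If Ig; exact: (integrableD mD If Ig). Qed.

Lemma integrable_subr f g : mu.-integrable D (EFin \o f) ->
  mu.-integrable D (EFin \o g) -> mu.-integrable D (EFin \o (fun x => f x - g x)).
Proof. by move=> If Ig; exact: (integrableB mD If Ig). Qed.

Lemma integrable_mulr c f : mu.-integrable D (EFin \o f) ->
  mu.-integrable D (EFin \o (fun x => c * f x)).
Proof. by move=> If; exact: (integrableZl mD c If). Qed.

End integrable_real.

Lemma measurable_dotv {R : realType} {dS} {S : measurableType dS} {d} (D : set S)
    (g h : S -> 'cV[R]_d) : measurable_fun D g -> measurable_fun D h ->
  measurable_fun D (fun x => dotv (g x) (h x)).
Proof.
move=> mg mh; apply: measurable_sum => i; apply: measurable_funM.
- exact: (measurableT_comp (measurable_coord i) mg).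
- exact: (measurableT_comp (measurable_coord i) mh).
Qed.

Lemma measurable_norm2 {R : realType} {dS} {S : measurableType dS} {d} (D : set S)
    (g : S -> 'cV[R]_d) : measurable_fun D g ->
  measurable_fun D (fun x => norm2 (g x)).
Proof.
move=> mg; under eq_fun do rewrite norm2E.
apply: (measurableT_comp _ (measurable_dotv mg mg)).
(* [Num.sqrt] is nondecreasing on all of [R], being [0] on negative numbers. *)
apply: nondecreasing_measurable => // a b ab.
by case: (leP 0 b) => b0; [rewrite ler_wsqrtr|rewrite !ltr0_sqrtr ?(le_lt_trans ab)].
Qed.

(** * Dependence of the gradient covariance on the field *)

Section covariance_perturbation.
Context {R : realType} {d : nat} (mu : {measure set 'cV[R]_d -> \bar R})
  (Om : set 'cV[R]_d).
Hypothesis mOm : measurable Om.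
Implicit Types f g h : 'cV[R]_d -> 'cV[R]_d.

Lemma integrable_norm2M g h : L2_field mu Om g -> L2_field mu Om h ->
  mu.-integrable Om (EFin \o (fun x => norm2 (g x) * norm2 (h x))).
Proof.
move=> [mg Ig] [mh Ih]; apply: (le_integrable mOm _ _ (integrableD mOm Ig Ih)).
  by apply/measurable_EFinP; apply: measurable_funM; exact: measurable_norm2.
move=> x _ /=; rewrite lee_fin.
have a0 := norm2_ge0 (g x); have b0 := norm2_ge0 (h x).
rewrite !ger0_norm ?mulr_ge0 ?addr_ge0 ?sqr_ge0 //; nra.
Qed.

Lemma integrable_norm2M_le (k : 'cV[R]_d -> R) (c : R) g h :
  measurable_fun Om k -> L2_field mu Om g -> L2_field mu Om h ->
  (forall x, `|k x| <= c * (norm2 (g x) * norm2 (h x))) ->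
  mu.-integrable Om (EFin \o k).
Proof.
move=> mk Lg Lh H.
apply: (le_integrable mOm _ _ (integrableZl mOm c (integrable_norm2M Lg Lh))).
  exact/measurable_EFinP.
by move=> x _ /=; rewrite lee_fin (le_trans (H x)) // ler_norm.
Qed.

Lemma L2_fieldB g h : L2_field mu Om g -> L2_field mu Om h ->
  L2_field mu Om (g \- h).
Proof.
move=> [mg Ig] [mh Ih].
have mgh : measurable_fun Om (g \- h).
  apply: measurable_fun_cV => i; under eq_fun do rewrite !mxE.
  apply: measurable_funB.
  - exact: (measurableT_comp (measurable_coord i) mg).
  - exact: (measurableT_comp (measurable_coord i) mh).
split => //; have Igh := integrableZl mOm 2 (integrableD mOm Ig Ih).
apply: (le_integrable mOm _ _ Igh).
  by apply/measurable_EFinP; apply: measurable_funX; exact: measurable_norm2.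
move=> x _ /=; rewrite lee_fin; apply: le_trans (ler_norm _).
rewrite ger0_norm ?sqr_ge0 // !sqr_norm2.
(* By the parallelogram law, the squared norm of the difference is at most twice the sum of the
   squares. *)
have := dotvv_ge0 (g x + h x).
rewrite /GRing.sub_fun dotvBl !dotvBr dotvDl !dotvDr (dotvC (h x)); lra.
Qed.

Lemma Rintegral_norm2M_le g h : L2_field mu Om g -> L2_field mu Om h ->
  \int[mu]_(x in Om) (norm2 (g x) * norm2 (h x)) <= L2_norm mu Om g * L2_norm mu Om h.
Proof.
move=> Lg Lh; apply: le_sqrtM_of_quad => s t.
have Igg : mu.-integrable Om (EFin \o (fun x => norm2 (g x) ^+ 2)) by case: Lg.
have Ihh : mu.-integrable Om (EFin \o (fun x => norm2 (h x) ^+ 2)) by case: Lh.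
have Igh := integrable_norm2M Lg Lh.
rewrite -!RintegralZl // -RintegralB //; try exact: integrable_mulr.
rewrite -RintegralD //; try exact: integrable_mulr; last first.
  by apply: integrable_subr => //; exact: integrable_mulr.
apply: Rintegral_ge0 => x _.
have -> : s ^+ 2 * norm2 (g x) ^+ 2 - 2 * (s * t) * (norm2 (g x) * norm2 (h x)) +
  t ^+ 2 * norm2 (h x) ^+ 2 = (s * norm2 (g x) - t * norm2 (h x)) ^+ 2 by ring.
exact: sqr_ge0.
Qed.

Lemma dotv_grad_cov g u v : L2_field mu Om g ->
  dotv u (grad_cov mu Om g *m v) =
  \int[mu]_(x in Om) (dotv u (g x) * dotv (g x) v).
Proof.
move=> Lg; have [mg _] := Lg.
have mgi i : measurable_fun Om (fun x => g x i ord0).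
  exact: (measurableT_comp (measurable_coord i) mg).
have Igg i j (c : R) : mu.-integrable Om
    (EFin \o (fun x => c * (g x i ord0 * g x j ord0))).
  apply: (@integrable_norm2M_le _ `|c| g g) => //.
    apply: measurable_funM => //; exact: measurable_funM.
  move=> x; rewrite !normrM ler_wpM2l // ler_pM // norm_coord_le //.
have Igg1 i j : mu.-integrable Om (EFin \o (fun x => (g x *m (g x)^T) i j)).
  rewrite (_ : _ \o _ = EFin \o (fun x => 1 * (g x i ord0 * g x j ord0))) //.
  by apply/funext => x /=; rewrite mulmx_trE mul1r.
transitivity (\sum_i \sum_j \int[mu]_(x in Om)
    ((u i ord0 * v j ord0) * (g x i ord0 * g x j ord0))).
  apply: eq_bigr => i _; rewrite mxE mulr_sumr; apply: eq_bigr => j _.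
  rewrite mxE mulrA mulrAC -RintegralZl //.
  by apply: eq_Rintegral => x _; rewrite mulmx_trE.
under eq_bigr => i _.
  rewrite -Rintegral_sum //; over.
rewrite -Rintegral_sum //; last first.
  move=> i; rewrite (_ : _ \o _ = fun x => (\sum_j (u i ord0 * v j ord0 *
      (g x i ord0 * g x j ord0))%:E)%E).
    by apply: integrable_sum => // j _; exact: Igg.
  by apply/funext => x /=; rewrite sumEFin.
apply: eq_Rintegral => x _; rewrite /dotv mulr_suml; apply: eq_bigr => i _.
by rewrite mulr_sumr; apply: eq_bigr => j _; ring.
Qed.

(** Up to sign, the difference of the outer products of [h] and [g] is [(g - h) h^T + g (g - h)^T];
    Cauchy-Schwarz is applied first pointwise, then under the integral. *)
Lemma opnorm_grad_covB_le g h : L2_field mu Om g -> L2_field mu Om h ->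
  opnorm (grad_cov mu Om h - grad_cov mu Om g) <=
  (L2_norm mu Om g + L2_norm mu Om h) * L2_norm mu Om (g \- h).
Proof.
move=> Lg Lh; have Lgh := L2_fieldB Lg Lh.
have [mg _] := Lg; have [mh _] := Lh.
have L0 f : 0 <= L2_norm mu Om f by exact: sqrtr_ge0.
apply: opnorm_le_dotv; first by rewrite mulr_ge0 ?addr_ge0.
move=> u v; rewrite mulmxBl dotvBr !dotv_grad_cov //.
have Iq f : L2_field mu Om f -> mu.-integrable Om
    (EFin \o (fun x => dotv u (f x) * dotv (f x) v)).
  move=> Lf; have [mf _] := Lf.
  apply: (@integrable_norm2M_le _ (norm2 u * norm2 v) f f) => //.
    by apply: measurable_funM; apply: measurable_dotv => //; exact: measurable_cst.
  move=> x; rewrite normrM [leRHS](_ : _ =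
    (norm2 u * norm2 (f x)) * (norm2 (f x) * norm2 v)); last by ring.
  by rewrite ler_pM ?ler_norm_dotv.
have I1 := integrable_norm2M Lg Lgh; have I2 := integrable_norm2M Lh Lgh.
rewrite -RintegralB //; try exact: Iq.
apply: (@le_trans _ _ (\int[mu]_(x in Om) (norm2 u * norm2 v *
    (norm2 (g x) * norm2 ((g \- h) x) + norm2 (h x) * norm2 ((g \- h) x))))).
  apply: le_Rintegral => //.
  - by apply: integrable_subr => //; exact: Iq.
  - by apply: integrable_mulr => //; exact: integrable_addr.
  - move=> x _.
    have -> : dotv u (h x) * dotv (h x) v - dotv u (g x) * dotv (g x) v =
      - (dotv u (g x - h x) * dotv (h x) v + dotv u (g x) * dotv (g x - h x) v).
      by rewrite dotvBl dotvBr; ring.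
    apply: (le_trans (ler_norm _)); rewrite normrN (le_trans (ler_normD _ _)) //.
    rewrite mulrDr [leRHS]addrC !normrM lerD //.
      rewrite [leRHS](_ : _ = (norm2 u * norm2 (g x - h x)) * (norm2 (h x) * norm2 v)).
        by rewrite ler_pM ?ler_norm_dotv.
      by rewrite /=; ring.
    rewrite [leRHS](_ : _ = (norm2 u * norm2 (g x)) * (norm2 (g x - h x) * norm2 v)).
      by rewrite ler_pM ?ler_norm_dotv.
    by rewrite /=; ring.
rewrite RintegralZl //; last exact: integrable_addr.
rewrite RintegralD // -[leRHS]mulrA [leRHS]mulrC.
rewrite ler_wpM2l ?mulr_ge0 ?norm2_ge0 // mulrDl lerD // Rintegral_norm2M_le //.
Qed.

End covariance_perturbation.

(** * Concentration of empirical covariances *)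

Section matrix_tail.
Context {R : realType} {d} {S : measurableType d} (P : probability S R).
Context {n N : nat} (Y : 'I_N -> S -> 'M[R]_n) (L : R).
Hypothesis bY : forall i, bounded_measurable_mx (Y i).
Hypothesis sY : forall i w, (Y i w)^T = Y i w.
Hypothesis YL : forall i w v, norm2 (Y i w *m v) <= L * norm2 v.
Hypothesis cY : forall i (A : {set 'I_N}) q, i \notin A ->
  \int[P]_w \tr (Y i w * (\sum_(j in A) Y j w) ^+ q) = 0.

(** The moment is at most [n * c ^+ p]. Markov at level [(expR 1 * c) ^+ p] leaves a failure
    probability of at most [n] divided by [expR 1 ^+ p], which is at most [eta] by the choice of
    [p]. *)
Lemma opnorm_sum_tail (eta : R) (p : nat) : 0 < L -> (0 < n)%N -> (0 < N)%N ->
  (0 < p)%N -> 0 < eta -> ln (n%:R / eta) <= p%:R ->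
  exists A, [/\ measurable A, ((1 - eta)%:E <= P A)%E &
    forall w, A w ->
      opnorm (\sum_i Y i w) <= L * Num.sqrt (4 * expR 1 * (p * N)%:R)].
Proof.
move=> L0 n0 N0 p0 eta0 lnp.
pose X w := \sum_(j in [set: 'I_N]%SET) Y j w.
have XE w : X w = \sum_i Y i w by apply: eq_bigl => i; rewrite inE.
have sX w : (X w)^T = X w by rewrite /X linear_sum /=; apply: eq_bigr => i _.
have bX : bounded_measurable (fun w => \tr (X w ^+ p.*2)).
  apply/bounded_measurable_mxtrace/bounded_measurable_mxX.
  exact: bounded_measurable_mx_sum.
pose c : R := (4 * p * N)%:R * L ^+ 2.
have c0 : 0 < c by rewrite mulr_gt0 ?exprn_gt0 // ltr0n !muln_gt0 p0 N0.
exists [set w | \tr (X w ^+ p.*2) <= (expR 1 * c) ^+ p]; split.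
- rewrite -[X in measurable X]setTI; apply: measurable_fun_le => //.
  by case: bX.
- apply: markov_bounded => //.
  + by move=> w; exact: mxtrace_exp_even_ge0.
  + by rewrite exprn_gt0 // mulr_gt0 // expR_gt0.
  + apply: (le_trans (mxtrace_moment_le bY sY YL cY _ p)).
    rewrite -/c [(expR 1 * c) ^+ p]exprMn mulrA ler_wpM2r ?exprn_ge0 ?(ltW c0) //.
    rewrite -ler_pdivrMl // mulrC -expRM_natl mulr1.
    by rewrite -[leLHS]lnK ?ler_expR // posrE divr_gt0 // ltr0n.
- move=> w /= trX; rewrite -XE.
  apply: (@opnorm_le_of_mxtrace_exp _ _ _ p) => //.
    by rewrite mulr_ge0 ?sqrtr_ge0 // ltW.
  apply: (le_trans trX).
  rewrite -mul2n [leRHS]exprM [(L * _) ^+ 2]exprMn sqr_sqrtr.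
    rewrite le_eqVlt; apply/orP; left; apply/eqP; congr (_ ^+ _).
    by rewrite /c !natrM; ring.
  by rewrite !mulr_ge0 ?expR_ge0.
Qed.

End matrix_tail.

Lemma normr_mx_le_opnorm {R : realType} m n (A : 'M[R]_(m, n)) i j :
  `|A i j| <= opnorm A.
Proof.
have -> : A i j = (A *m (delta_mx j ord0 : 'cV[R]_n)) i ord0 by rewrite -colE mxE.
apply: (le_trans (norm_coord_le _ _)); apply: (le_trans (norm2_mulmx_le _ _)).
by rewrite norm2_delta mulr1.
Qed.

(** * Concentration for a field bounded everywhere *)

Section bounded_field.
Context {R : realType} {d N : nat} {dS dT} {S : measurableType dS}
  {T : measurableType dT} (P : probability S R)
  (mu : {sigma_finite_measure set 'cV[R]_d -> \bar R})
  (theta : S -> T) (X : 'I_N -> S -> 'cV[R]_d).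
Hypothesis mu1 : mu [set: 'cV[R]_d] = 1%E.
Hypothesis iid : iid_given P mu theta X.
Context (h : T * 'cV[R]_d -> 'cV[R]_d) (M : R).
Hypothesis mh : forall i, measurable_fun [set: T * 'cV[R]_d] (fun p => h p i ord0).
Hypothesis hM : forall p, norm2 (h p) ^+ 2 <= M.

Let M0 : 0 <= M.
Proof. exact: le_trans (sqr_ge0 _) (hM (point, 0)). Qed.

Let Cb t := grad_cov mu [set: 'cV[R]_d] (fun x => h (t, x)).
Let y p := h p *m (h p)^T - Cb p.1.

Let muT : (mu [set: 'cV[R]_d] < +oo)%E.
Proof. by rewrite [X in (X < _)%E]mu1 ltry. Qed.

Let mht t : measurable_fun [set: 'cV[R]_d] (fun x => h (t, x)).
Proof.
apply: measurable_fun_cV => i.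
exact: (measurableT_comp (mh i) (pair1_measurable t)).
Qed.

Let L2h t : L2_field mu [set: 'cV[R]_d] (fun x => h (t, x)).
Proof.
split => //; apply: measurable_bounded_integrable => //.
  by apply: measurable_funX; apply: measurable_norm2.
exists M; split; [exact: num_real|move=> x Mx w _ /=].
by rewrite ger0_norm ?sqr_ge0 // (le_trans (hM _)) // ltW.
Qed.

Let dotv_hM u v p : `|dotv u (h p) * dotv (h p) v| <= M * norm2 u * norm2 v.
Proof.
apply: (@le_trans _ _ (norm2 (h p) ^+ 2 * (norm2 u * norm2 v))).
  rewrite normrM [leRHS](_ : _ = (norm2 u * norm2 (h p)) * (norm2 (h p) * norm2 v)).
    by rewrite ler_pM ?ler_norm_dotv.
  by ring.
by rewrite -mulrA ler_wpM2r ?mulr_ge0 ?norm2_ge0.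
Qed.

Let opnorm_Cb t : opnorm (Cb t) <= M.
Proof.
apply: opnorm_le_dotv => // u v; rewrite dotv_grad_cov //.
have -> : M * norm2 u * norm2 v = \int[mu]_x (M * norm2 u * norm2 v).
  by rewrite Rintegral_cst // [X in fine X]mu1 mulr1.
apply: le_Rintegral => //.
- apply: measurable_bounded_integrable => //.
    apply: measurable_funM; apply: measurable_dotv => //; exact: measurable_cst.
  exists (M * norm2 u * norm2 v); split; [exact: num_real|move=> x Mx w _ /=].
  by rewrite (le_trans (dotv_hM _ _ _)) // ltW.
- apply: measurable_bounded_integrable => //; exact: bounded_cst.
- by move=> x _; exact: le_trans (ler_norm _) (dotv_hM _ _ _).
Qed.

Let bhh : bounded_measurable_mx (fun p => h p *m (h p)^T).
Proof.
move=> i j; split.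
  by under eq_fun do rewrite mulmx_trE; apply: measurable_funM.
exists M => p; rewrite mulmx_trE normrM (le_trans _ (hM p)) // expr2.
by rewrite ler_pM ?norm_coord_le.
Qed.

Let by_ : bounded_measurable_mx y.
Proof.
move=> i j; have [mhh [B hhB]] := bhh i j.
under eq_fun do rewrite mxE [X in _ + X]mxE.
apply: bounded_measurableD; first exact: bhh.
split; last first.
  by exists M => p; rewrite normrN (le_trans (normr_mx_le_opnorm _ _ _)).
apply: measurableT_comp => //.
have mCb : measurable_fun [set: T] (fun t => Cb t i j).
  by under eq_fun do rewrite mxE; exact: (measurable_fun_Rintegral mu mhh).
exact: (measurableT_comp mCb).
Qed.

Let sy p : (y p)^T = y p.
Proof.
rewrite /y linearB /= trmx_mul trmxK; congr (_ - _).
apply/matrixP => i j; rewrite !mxE; apply: eq_Rintegral => x _.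
by rewrite !mulmx_trE mulrC.
Qed.

Let yM p v : norm2 (y p *m v) <= 2 * M * norm2 v.
Proof.
rewrite mulmxBl (le_trans (ler_norm2D _ _)) //.
rewrite -scaleN1r norm2Z normrN1 mul1r -mulrA mulr_natl mulr2n lerD //.
  have -> : h p *m (h p)^T *m v = dotv (h p) v *: h p.
    by rewrite -mulmxA [_ *m v]mx11_scalar -dotvE mul_mx_scalar.
  rewrite norm2Z; apply: (@le_trans _ _ (norm2 (h p) ^+ 2 * norm2 v)).
    rewrite expr2 mulrAC ler_wpM2r ?norm2_ge0 ?ler_norm_dotv //.
  by rewrite ler_wpM2r ?norm2_ge0.
by rewrite (le_trans (norm2_mulmx_le _ _)) // ler_wpM2r ?norm2_ge0.
Qed.

Let y0 t a b : \int[mu]_x y (t, x) a b = 0.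
Proof.
have [mhh [B hhB]] := bhh a b.
have -> : \int[mu]_x y (t, x) a b =
    \int[mu]_x ((h (t, x) *m (h (t, x))^T) a b - Cb t a b).
  by apply: eq_Rintegral => x _; rewrite /y [LHS]mxE [X in _ + X]mxE.
rewrite RintegralB //.
- by rewrite Rintegral_cst // [X in fine X]mu1 mulr1 [X in _ - X]mxE subrr.
- apply: measurable_bounded_integrable => //.
    exact: (measurableT_comp mhh (pair1_measurable _)).
  by exists B; split; [exact: num_real|move=> x Bx w _; exact: le_trans (hhB _) (ltW Bx)].
- apply: measurable_bounded_integrable => //; exact: bounded_cst.
Qed.

Lemma empirical_cov_tail (eta : R) : (1 < d)%N -> (0 < N)%N -> 0 < eta < 1 ->
  exists A, [/\ measurable A, ((1 - eta)%:E <= P A)%E &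
    forall w, A w ->
      opnorm (empirical_cov (fun x => h (theta w, x)) (fun n => X n w) -
        grad_cov mu [set: 'cV[R]_d] (fun x => h (theta w, x))) <=
      4 * Num.sqrt (3 * expR 1) * (M * Num.sqrt (ln (d%:R / eta) / N%:R))].
Proof.
move=> d1 N0 /andP[eta0 eta1].
pose Y i w := y (theta w, X i w).
have empE w : empirical_cov (fun x => h (theta w, x)) (fun n => X n w) -
    grad_cov mu [set: 'cV[R]_d] (fun x => h (theta w, x)) =
    N%:R^-1 *: \sum_i Y i w.
  have -> : \sum_i Y i w = \sum_i h (theta w, X i w) *m (h (theta w, X i w))^T -
      \sum_(i < N) Cb (theta w) by rewrite -sumrB.
  rewrite scalerBr sumr_const card_ord -[Cb _ *+ N]scaler_nat scalerA mulVf ?scale1r //.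
  by rewrite pnatr_eq0 -lt0n.
set l := ln _.
(* As [d] is at least [2] and [eta < 1], [l] is at least [ln 2]; the bound [ln (1 + x) <= x] at
   [x = - 2^-1] shows [ln 2 >= 2^-1]. *)
have l_ge : 2^-1 <= l.
  apply: (@le_trans _ _ (ln 2)).
    have := @le_ln1Dx R (- 2^-1); rewrite (_ : 1 + - 2^-1 = 2^-1); last by field.
    by rewrite lnV ?posrE // lerN2; apply; lra.
  rewrite ler_ln ?posrE ?divr_gt0 ?ltr0n ?(ltnW d1) // ler_pdivlMr //.
  have : 2 <= d%:R :> R by rewrite ler_nat.
  by move: eta0 eta1; nra.
have l0 : 0 <= l by lra.
(* The least integer above [l]; since [1 <= 2 * l], it is at most [3 * l], the source of the [3] in
   the constant. *)
pose p := (Num.truncn l).+1.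
have /andP[pl lp] := truncn_itv l0.
have pb : p%:R <= 3 * l by rewrite -[leLHS]natr1; lra.
have opnormZ (c : R) (A : 'M[R]_d) B : 0 <= c -> opnorm A <= B ->
    opnorm (c *: A) <= c * B.
  move=> c0 AB; apply: opnorm_le.
    by rewrite mulr_ge0 // (le_trans (opnorm_ge0 A)).
  move=> v; rewrite -scalemxAl norm2Z ger0_norm // -mulrA ler_wpM2l //.
  by rewrite (le_trans (norm2_mulmx_le _ _)) // ler_wpM2r ?norm2_ge0.
have NV0 : 0 <= N%:R^-1 :> R by rewrite invr_ge0.
have N0' : 0 < N%:R :> R by rewrite ltr0n.
(* The tail bound asks for [0 < L]; for [M = 0] all deviations vanish. *)
have [M00|Mn0] := eqVneq M 0.
  exists [set: S]; split => //.
    by rewrite probability_setT lee_fin gerBl ltW.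
  move=> w _; rewrite empE M00 mul0r mulr0 -(mulr0 N%:R^-1).
  apply: opnormZ => //; apply: opnorm_le => // v; rewrite mul0r mulmx_suml.
  apply: (le_trans (norm2_sum_le _ _)).
  apply: sumr_le0 => i _; apply: (le_trans (yM _ _)).
  by rewrite M00 mulr0 mul0r.
have Mp : 0 < M by rewrite lt_neqAle eq_sym Mn0.
have [| | | | | | | | | | A [mA PA HA]] :=
  @opnorm_sum_tail _ _ _ P d N Y (2 * M) _ _ _ _ eta p.
- move=> i a b; have [my [B yB]] := by_ a b; split; last by exists B => w; exact: yB.
  have [mtheta mX _] := iid.
  by apply: (measurableT_comp my); exact/measurable_fun_pair.
- by move=> i w; exact: sy.
- by move=> i w v; exact: yM.
- by move=> i A q iA; exact: (iid_given_centered mu1 iid q by_ y0 iA).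
- by rewrite mulr_gt0.
- exact: ltnW.
- by [].
- by [].
- by [].
- exact: ltW.
exists A; split => // w /HA Aw; rewrite empE.
apply: (le_trans (opnormZ _ _ _ NV0 Aw)).
have -> : N%:R^-1 * (2 * M * Num.sqrt (4 * expR 1 * (p * N)%:R)) =
    4 * M * Num.sqrt (expR 1 * p%:R / N%:R).
  have -> : expR 1 * p%:R / N%:R = 4 * expR 1 * (p * N)%:R / (2 * N%:R) ^+ 2 :> R.
    by rewrite natrM; field; rewrite gt_eqF.
  rewrite [in RHS]sqrtrM ?mulr_ge0 ?expR_ge0 // sqrtrV ?sqr_ge0 // sqrtr_sqr.
  rewrite gtr0_norm ?mulr_gt0 //.
  by field; rewrite gt_eqF.
have -> : 4 * Num.sqrt (3 * expR 1) * (M * Num.sqrt (l / N%:R)) =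
    4 * M * Num.sqrt (3 * expR 1 * (l / N%:R)).
  by rewrite [in RHS]sqrtrM ?mulr_ge0 ?expR_ge0 //; ring.
rewrite ler_wpM2l ?mulr_ge0 // ler_wsqrtr // mulrA ler_wpM2r //.
by rewrite [leRHS]mulrAC mulrC ler_wpM2r ?expR_ge0.
Qed.

End bounded_field.

(** * Reduction of an almost surely bounded field to a bounded one *)

Section almost_surely_bounded_field.
Context {R : realType} {d N : nat} {dS dT} {S : measurableType dS}
  {T : measurableType dT} (P : probability S R)
  (mu : {sigma_finite_measure set 'cV[R]_d -> \bar R})
  (theta : S -> T) (X : 'I_N -> S -> 'cV[R]_d) (Om : set 'cV[R]_d)
  (g : T -> 'cV[R]_d -> 'cV[R]_d) (G : R).
Hypothesis mu1 : mu [set: 'cV[R]_d] = 1%E.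
Hypothesis mOm : measurable Om.
Hypothesis iid : iid_given P mu theta X.
Hypothesis XOm : forall n w, Om (X n w).
Hypothesis mg : measurable_fun ([set: T] `*` Om) (fun p => g p.1 p.2).
Hypothesis gG :
  {ae P, forall w, {ae mu, forall x, Om x -> norm2 (g (theta w) x) <= G}}.

Let mTOm : measurable ([set: T] `*` Om).
Proof. exact: measurableX. Qed.

(** Extension by zero: [g] is measurable on [Om] only, whereas the law [mu] lives on the whole
    space. *)
Let F (p : T * 'cV[R]_d) : 'cV[R]_d :=
  \col_i (((fun p => g p.1 p.2 i ord0) \_ ([set: T] `*` Om)) p).

Let F_in t x : Om x -> F (t, x) = g t x.
Proof. by move=> Ox; apply/colP => i; rewrite mxE patchE mem_set. Qed.

Let F_out t x : ~ Om x -> F (t, x) = 0.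
Proof.
move=> Ox; apply/colP => i; rewrite !mxE patchE memNset //.
by move=> [_ /=].
Qed.

Let mFi i : measurable_fun [set: T * 'cV[R]_d] (fun p => F p i ord0).
Proof.
under eq_fun do rewrite mxE.
apply/(measurable_restrictT _ mTOm).
exact: (measurableT_comp (measurable_coord i) mg).
Qed.

Let mF : measurable_fun [set: T * 'cV[R]_d] F.
Proof. exact: measurable_fun_cV. Qed.

Let bad : set (T * 'cV[R]_d) :=
  ([set: T] `*` Om) `&` [set p | G < norm2 (F p)].

Let mbad : measurable bad.
Proof.
apply: measurableI => //; rewrite -[X in measurable X]setCK; apply: measurableC.
rewrite (_ : ~` _ = [set: _] `&` [set p | norm2 (F p) <= G]).
  by apply: measurable_fun_le => //; exact: measurable_norm2.
by rewrite setTI; apply/seteqP; split => p /=; rewrite leNgt; move/negP.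
Qed.

(** The truncation, zero where the bound [G] fails. For a good [theta] it changes neither the
    covariance nor, almost surely, the sampled gradients. *)
Let h (p : T * 'cV[R]_d) : 'cV[R]_d := \1_(~` bad) p *: F p.

Let h_good p : ~ bad p -> h p = F p.
Proof. by move=> bp; rewrite /h indicE mem_set // scale1r. Qed.

Let h_bad p : bad p -> h p = 0.
Proof. by move=> bp; rewrite /h indicE memNset ?scale0r // => /(_ bp). Qed.

Let mh i : measurable_fun [set: T * 'cV[R]_d] (fun p => h p i ord0).
Proof.
under eq_fun do rewrite mxE; apply: measurable_funM => //.
by apply: measurable_indic; exact: measurableC.
Qed.

Let hG p : norm2 (h p) ^+ 2 <= G ^+ 2.
Proof.
have [bp|bp] := pselect (bad p).
  by rewrite h_bad // norm2_0 expr0n /= sqr_ge0.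
rewrite h_good //; case: p bp => t x bp.
have [Ox|Ox] := pselect (Om x); last by rewrite F_out // norm2_0 expr0n /= sqr_ge0.
have FG : norm2 (F (t, x)) <= G by rewrite leNgt; apply/negP => GF; apply: bp.
by rewrite lerXn2r // nnegrE ?norm2_ge0 // (le_trans (norm2_ge0 _) FG).
Qed.

Let good t := {ae mu, forall x, Om x -> norm2 (g t x) <= G}.

Let good_h t : good t -> {ae mu, forall x, ~ bad (t, x)}.
Proof.
apply: filterS => x Gx [[_ /= Ox] /=].
by rewrite F_in // ltNge Gx.
Qed.

Let grad_cov_F t :
  grad_cov mu Om (g t) = grad_cov mu [set: 'cV[R]_d] (fun x => F (t, x)).
Proof.
apply/matrixP => i j; rewrite !mxE Rintegral_mkcond.
apply: eq_Rintegral => x _; rewrite patchE mulmx_trE.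
have [Ox|Ox] := pselect (Om x); first by rewrite mem_set // F_in // mulmx_trE.
by rewrite memNset // F_out // mul0mx mxE.
Qed.

Let grad_cov_h t : good t ->
  grad_cov mu Om (g t) = grad_cov mu [set: 'cV[R]_d] (fun x => h (t, x)).
Proof.
move=> gt; rewrite grad_cov_F; apply/matrixP => i j; rewrite !mxE.
have mprod (k : T * 'cV[R]_d -> 'cV[R]_d) :
    (forall i, measurable_fun [set: T * 'cV[R]_d] (fun p => k p i ord0)) ->
    measurable_fun [set: 'cV[R]_d]
      (fun x => ((k (t, x) *m (k (t, x))^T) i j)%:E).
  move=> mk; apply/measurable_EFinP.
  under eq_fun do rewrite mulmx_trE.
  by apply: measurable_funM; exact: (measurableT_comp (mk _) (pair1_measurable t)).
congr fine; apply: ae_eq_integral => //; [exact: mprod|exact: mprod|].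
by apply: filterS (good_h gt) => x bx _; rewrite h_good.
Qed.

(** Under the product law of [theta] and [X n], the probability is the mean of the [mu]-measures of
    the sections of [bad], almost all of which are null. *)
Let bad_null n : P ((fun w => (theta w, X n w)) @^-1` bad) = 0%E.
Proof.
rewrite (iid_given_joint_law mu1 iid n mbad) /product_measure1.
rewrite ge0_integral_distribution //; last exact: (measurable_fun_xsection mu mbad).
rewrite (ge0_ae_eq_integral (g := cst 0%E)) //.
- by rewrite integral0.
- apply: (measurableT_comp (measurable_fun_xsection mu mbad)).
  by case: iid.
- apply: filterS gG => w /good_h [B [mB B0 badB]] _ /=.
  apply/eqP; rewrite eq_le measure_ge0 andbT -B0 le_measure ?inE //.
    exact: measurable_xsection.
  move=> x; rewrite /xsection /= inE => bx; apply: badB => /=.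
  by move=> /(_ bx).
Qed.

Let ae_h : {ae P, forall w, good (theta w) /\ forall n, ~ bad (theta w, X n w)}.
Proof.
apply: filterI => //.
have FF : Filter (almost_everywhere P) by exact: ae_filter_ringOfSetsType.
apply: (@filter_forall _ _ (fun n w => ~ bad (theta w, X n w)) _ FF) => n.
have [mtheta mX _] := iid.
exists ((fun w => (theta w, X n w)) @^-1` bad); split => //.
  rewrite -[X in measurable X]setTI.
  have : measurable_fun [set: S] (fun w => (theta w, X n w)).
    exact/measurable_fun_pair.
  exact.
by move=> w /= /contrapT.
Qed.

Let measurable_deviation (b : R) : 0 <= b ->
  measurable [set w | opnorm (empirical_cov (g (theta w)) (fun n => X n w) -
    grad_cov mu Om (g (theta w))) <= b].
Proof.
move=> b0; have [mtheta mX _] := iid; apply: measurable_opnorm_le => // i j.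
under eq_fun do rewrite mxE [X in _ + X]mxE grad_cov_F.
apply: measurable_funB.
  under eq_fun do rewrite mxE summxE.
  apply: measurable_funM => //; apply: measurable_sum => n.
  rewrite (_ : (fun _ => _) =
      fun w => F (theta w, X n w) i ord0 * F (theta w, X n w) j ord0); last first.
    by apply/funext => w; rewrite F_in // mulmx_trE.
  have mtX : measurable_fun [set: S] (fun w => (theta w, X n w)).
    exact/measurable_fun_pair.
  by apply: measurable_funM; exact: (measurableT_comp (mFi _) mtX).
have mFF : measurable_fun [set: T * 'cV[R]_d] (fun p => (F p *m (F p)^T) i j).
  by under eq_fun do rewrite mulmx_trE; apply: measurable_funM.
have mC : measurable_fun [set: T]
    (fun t => grad_cov mu [set: 'cV[R]_d] (fun x => F (t, x)) i j).
  by under eq_fun do rewrite mxE; exact: (measurable_fun_Rintegral mu mFF).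
exact: (measurableT_comp mC mtheta).
Qed.

Lemma empirical_cov_concentration (eta : R) : (1 < d)%N -> (0 < N)%N ->
  0 < eta < 1 ->
  ((1 - eta)%:E <= P [set w |
    (opnorm (empirical_cov (g (theta w)) (fun n => X n w) -
       grad_cov mu Om (g (theta w))) <=
     4 * Num.sqrt (3 * expR 1) * (G ^+ 2 * Num.sqrt (ln (d%:R / eta) / N%:R)))%R])%E.
Proof.
move=> d1 N0 eta01.
have [A [mA PA HA]] := empirical_cov_tail mu1 iid mh hG d1 N0 eta01.
set b := 4 * _ * _; set E := [set w | _].
have mE : measurable E.
  apply: measurable_deviation; apply: mulr_ge0.
    by rewrite mulr_ge0 ?sqrtr_ge0.
  by rewrite mulr_ge0 ?sqr_ge0 ?sqrtr_ge0.
have [B [mB PB badB]] := ae_h.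
(* Outside the null set [B] the truncated and original deviations agree, so [A] lies in the union of
   [E] and [B]. *)
apply: (le_trans PA); apply: (@le_trans _ _ (P (E `|` B))).
  apply: le_measure; rewrite ?inE //; first exact: measurableU.
  move=> w Aw; have [Bw|nBw] := pselect (B w); [by right|left].
  have [gw bw] : good (theta w) /\ forall n, ~ bad (theta w, X n w).
    by apply: contrapT => nw; apply: nBw; exact: badB.
  rewrite /E /= grad_cov_h //.
  have -> : empirical_cov (g (theta w)) (fun n => X n w) =
      empirical_cov (fun x => h (theta w, x)) (fun n => X n w).
    congr (_ *: _); apply: eq_bigr => n _.
    by rewrite h_good // F_in.
  exact: HA.
by apply: (le_trans (measureU2 _ mE mB)); rewrite [X in (_ + X)%E]PB adde0.
Qed.

End almost_surely_bounded_field.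

(** * Assembly of the perturbation and concentration bounds *)

Lemma product_measure_setT {R : realType} d
    (rho : 'I_d -> probability (measurableTypeR R) R) :
  product_measure (fun i => rho i) [set: 'cV[R]_d] = 1%E.
Proof.
pose A := fun _ : 'I_d => [set: measurableTypeR R].
have -> : [set: 'cV[R]_d] = [set x | forall i, A i (x i ord0)].
  by apply/seteqP; split.
rewrite product_measure_box; last by move=> i; exact: measurableT.
by rewrite big1 // => i _; exact: probability_setT.
Qed.

(* c is the implicit constant in the lower bound on N, K the one in O(.).
   The predictor ut t depends on a training outcome t : T; the random training
   outcome is theta : S -> T and the random sample is X : 'I_N -> S -> R^d. *)
Theorem corollary4p9 (R : realType) (c : R) (c_gt0 : 0 < c) :
  exists2 K : R, 0 < K &
  forall (d r N : nat) (J : 'I_d -> set R)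
    (rho : 'I_d -> probability (measurableTypeR R) R)
    (u : 'cV[R]_d -> R) (gu : 'cV[R]_d -> 'cV[R]_d)
    (dS dT : measure_display) (S : measurableType dS) (T : measurableType dT)
    (P : probability S R) (theta : S -> T) (X : 'I_N -> S -> 'cV[R]_d)
    (ut : T -> 'cV[R]_d -> R) (gut : T -> 'cV[R]_d -> 'cV[R]_d)
    (nu : d.-tuple R),
  let Omega := product_domain J in
  let mu := product_measure (fun i => rho i) in
  let Cu := grad_cov mu Omega gu in
  let Ct t := grad_cov mu Omega (gut t) in
  let Chat w := empirical_cov (gut (theta w)) (fun n => X n w) in
  let Delta := nu`_r.-1 - nu`_r in
  (0 < N)%N ->
  (forall i, open (J i) /\ connected (J i)) ->
  (forall i, rho i (J i) = 1%E) ->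
  weak_gradient Omega u gu -> L2_field mu Omega gu ->
  (forall t, weak_gradient Omega (ut t) (gut t) /\ L2_field mu Omega (gut t)) ->
  measurable_fun ([set: T] `*` Omega) (fun p => gut p.1 p.2) ->
  iid_given P mu theta X -> (forall n w, Omega (X n w)) ->
  eigenvalues Cu nu -> (forall x, x \in nu -> 0 <= x) ->
  (1 <= r < d)%N -> 0 < Delta ->
  (forall (w : S) (W What : 'M[R]_(d, r)) (angles : 'rV[R]_r),
     opnorm (Chat w - Ct (theta w)) + opnorm (Ct (theta w) - Cu) <= Delta / 2 ->
     leading_eigenbasis Cu W -> leading_eigenbasis (Chat w) What ->
     principal_angles What W angles ->
     opnorm (sin_Theta angles) <=
       2 / Delta * (opnorm (Chat w - Ct (theta w)) +
         (L2_norm mu Omega gu + L2_norm mu Omega (gut (theta w))) *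
         L2_norm mu Omega (gu \- gut (theta w)))) /\
  (forall G eta : R,
     {ae P, forall w, {ae mu, forall x, Omega x -> norm2 (gut (theta w) x) <= G}} ->
     0 < eta < 1 -> c * ln (d%:R / eta) <= N%:R ->
     ((1 - eta)%:E <=
       P [set w | (opnorm (Chat w - Ct (theta w)) <=
                  K * (G ^+ 2 * Num.sqrt (ln (d%:R / eta) / N%:R)))%R])%E).
Proof.
exists (4 * Num.sqrt (3 * expR 1)).
  by rewrite mulr_gt0 // sqrtr_gt0 mulr_gt0 // expR_gt0.
move=> d r N J rho u gu dS dT S T P theta X ut gut nu Omega mu Cu Ct Chat Delta.
move=> N0 oJ _ _ Lgu Lgut mgut iid XOm nuCu _ r1d D0.
have mOm : measurable Omega.
  apply: (measurable_box (A := J)) => i; have [oi _] := oJ i.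
  exact: open_measurable.
split.
  move=> w W What angles le_gap lW lWhat ang.
  have CtCu : opnorm (Ct (theta w) - Cu) <=
      (L2_norm mu Omega gu + L2_norm mu Omega (gut (theta w))) *
      L2_norm mu Omega (gu \- gut (theta w)).
    by apply: opnorm_grad_covB_le => //; case: (Lgut (theta w)).
  (* Davis-Kahan compares [Chat w] with [Cu] directly; this triangle inequality supplies both its
     smallness hypothesis and the final splitting. *)
  have CC : opnorm (Chat w - Cu) <=
      opnorm (Chat w - Ct (theta w)) + opnorm (Ct (theta w) - Cu).
    by rewrite -(subrKA (Ct (theta w))) opnormD.
  apply: (le_trans (davis_kahan r1d D0 nuCu (le_trans CC le_gap) lW lWhat ang)).
  by rewrite ler_wpM2l ?divr_ge0 ?(ltW D0) // (le_trans CC) // lerD2l.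
move=> G eta gG eta01 _.
(* [1 <= r < d] gives [1 < d], which keeps the logarithm away from zero. *)
have /andP[r1 rd] := r1d.
by apply: empirical_cov_concentration => //;
  [exact: product_measure_setT|exact: leq_ltn_trans rd].
Qed.
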